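(* Let $1<p\le 2$. There exists a constant $C_p$, depending only on $p$, such that the following holds. Let $\{I_k\}_k$ be any finite or countable family of pairwise disjoint rectangles $I_k=I_k^1\times I_k^2\subseteq\mathbb{Z}_+\times\mathbb{Z}_+$, where each $I_k^1,I_k^2$ is an interval of $\mathbb{Z}_+$, and let $\{f_k\}_k$ be any family of functions $f_k\in L^2([0,1]^2)$ with Walsh spectrum inside $I_k$, meaning that $$f_k(x_1,x_2)=\sum_{(n_1,n_2)\in I_k}(f_k,\,w_{n_1}w_{n_2})\,w_{n_1}(x_1)\,w_{n_2}(x_2).$$ Then $$\Big\|\sum_k f_k\Big\|_{L^p}\le C_p\,\Big\|\Big(\sum_k|f_k|^2\Big)^{1/2}\Big\|_{L^p}.$$ In particular, $C_p$ does not depend on the choice of the rectangles $\{I_k\}$ or of the functions $\{f_k\}$.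
   Context: $\mathbb{Z}_+=\{0,1,2,\dots\}$; an interval of $\mathbb{Z}_+$ is a nonempty set of consecutive nonnegative integers. $L^p=L^p([0,1]^2)$ with Lebesgue measure, and $(\cdot,\cdot)$ is the inner product of $L^2([0,1]^2)$. The Walsh functions $w_n$, $n\in\mathbb{Z}_+$ (in the Paley ordering), are the functions of one real variable defined as follows: $w_0=1$, and if $n=2^{k_1}+\dots+2^{k_s}$ with $k_1>k_2>\dots>k_s\ge 0$, then $w_n(x)=\prod_{i=1}^s r_{k_i+1}(x)$, where $r_k(x)=\operatorname{sgn}\sin(2^k\pi x)$. In $(f_k,w_{n_1}w_{n_2})$ the product denotes the function $(x_1,x_2)\mapsto w_{n_1}(x_1)w_{n_2}(x_2)$; these functions form an orthonormal basis of $L^2([0,1]^2)$. The series representing $f_k$ is understood as convergent in $L^2$. If the family is infinite, the inequality is trivial when the right-hand side is infinite; when the right-hand side is finite, $\sum_k f_k$ is understood as the limit of partial sums in $L^p$. *)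

(* Defs.v *)
(* MathComp-Analysis. *)
From HB Require Import structures.
From mathcomp Require Import all_boot all_order all_algebra finmap.
From mathcomp Require Import all_classical all_reals all_analysis.
From mathcomp.real_closed Require Import complex.
From mathcomp.analysis.showcase Require Import summability.
Set Implicit Arguments.
Unset Strict Implicit.
Unset Printing Implicit Defensive.
Import Order.TTheory GRing.Theory Num.Theory.
Import numFieldNormedType.Exports.
Local Open Scope classical_set_scope.
Local Open Scope ring_scope.

Definition unit_square (R : realType) :
    set (measurableTypeR R * measurableTypeR R) :=
  `[0, 1] `*` `[0, 1].

Lemma measurable_unit_square (R : realType) : measurable (@unit_square R).
Proof. by apply: measurableX; exact: measurable_itv. Qed.

(* Functions on [0,1]^2 are represented by functions on the whole plane; the
   measure below ignores their values outside the square. *)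
Definition lebesgue_square (R : realType) :
    {measure set (measurableTypeR R * measurableTypeR R) -> \bar R} :=
  mrestr ((@lebesgue_measure R) \x (@lebesgue_measure R))%E
    (@measurable_unit_square R).
Arguments lebesgue_square R : clear implicits.

Section Lp.
Variable R : realType.
Local Notation T := (measurableTypeR R * measurableTypeR R)%type.
Local Notation mu := (lebesgue_square R).
Implicit Types (f g : T -> R[i]) (p : R).

Definition cnorm p f : \bar R :=
  ('N[mu]_(p%:E)[EFin \o (@Normc.normc R \o f)])%E.

Definition in_Lp p f : Prop :=
  [/\ measurable_fun setT (fun x => complex.Re (f x)),
      measurable_fun setT (fun x => complex.Im (f x))
    & (cnorm p f < +oo)%E].

Definition cintegral f : R[i] :=
  Complex (\int[mu]_x complex.Re (f x))%R (\int[mu]_x complex.Im (f x))%R.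

Definition cdot f g : R[i] := cintegral (fun x => f x * conjc (g x)).

Definition Lp_limit (A : Type) (Phi : set_system A) p
    (S : A -> T -> R[i]) (F : T -> R[i]) : Prop :=
  in_Lp p F /\ cnorm p (fun x => S a x - F x) @[a --> Phi] --> 0%E.

End Lp.

Section Walsh.
Variable R : realType.
Local Notation T := (measurableTypeR R * measurableTypeR R)%type.

Definition rademacher (k : nat) (x : R) : R := Num.sg (sin (2 ^+ k * pi * x)).

(* The product ranges over the positions k of the binary digits 1 of n; the
   bound k < n loses none of them, since 2 ^ k <= n implies k < n. *)
Definition walsh (n : nat) (x : R) : R :=
  \prod_(0 <= k < n | odd (n %/ 2 ^ k)) rademacher k.+1 x.

Definition walsh2 (n : nat * nat) (x : T) : R[i] :=
  (walsh n.1 x.1 * walsh n.2 x.2)%:C%C.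

(* The sum over the possibly infinite set [I] is the limit in L^2 along the
   directed set of finite index sets. *)
Definition walsh_spectrum_in (I : set (nat * nat)) (f : T -> R[i]) : Prop :=
  Lp_limit totally 2
    (fun (A : {fset nat * nat}) x =>
       \sum_(n <- A | n \in I) cdot f (walsh2 n) * walsh2 n x) f.

Definition nat_interval (I : set nat) : Prop :=
  I !=set0 /\ forall a b c, I a -> I c -> (a <= b <= c)%N -> I b.

Definition disjoint_rectangles (K : Type) (I1 I2 : K -> set nat) : Prop :=
  [/\ forall k, nat_interval (I1 k), forall k, nat_interval (I2 k)
    & trivIset setT (fun k => I1 k `*` I2 k)].

Definition walsh_family (K : Type) (I1 I2 : K -> set nat) (f : K -> T -> R[i]) :
    Prop :=
  forall k, in_Lp 2 (f k) /\ walsh_spectrum_in (I1 k `*` I2 k) (f k).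

(* The values may be infinite when [K] is. *)
Definition square_function (K : choiceType) (f : K -> T -> R[i]) (x : T) :
    \bar R :=
  ((\esum_(k in [set: K]) (Normc.normc (f k x) ^+ 2)%:E) `^ 2^-1)%E.

End Walsh.

(* Main.v *)
Require Import Defs.
From HB Require Import structures.
From mathcomp Require Import all_boot all_order all_algebra finmap.
From mathcomp Require Import all_classical all_reals all_analysis.
From mathcomp Require Import measurable_realfun.
From mathcomp.real_closed Require Import complex.
From mathcomp Require Import ring lra zify.
Import Order.TTheory GRing.Theory Num.Theory.
Import numFieldNormedType.Exports.
Local Open Scope classical_set_scope.
Local Open Scope ring_scope.
Set Implicit Arguments.
Unset Strict Implicit.
Unset Printing Implicit Defensive.

(** The inequality comes from a finite model.  Walsh functions are the
characters of the group of binary sequences, and a Walsh polynomial is a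
function on X * X with X = {0,1}^N; the constants obtained on X * X do not
depend on N.

An interval [a, b) of frequencies is the disjoint union of its maximal dyadic
subintervals, and each of these is a xor-translate e xor [2^i, 2^(i+1)) of a
Littlewood-Paley block, with e = a - 1 or e = b ([piece_exists],
[piece_unique]).  Therefore the projection on such a piece is a martingale
difference, conjugated by the character of frequency e.  In two variables a
rectangle is covered by four families of this kind, one for each corner.

Splitting.  For 1 < p <= 2 the square function of an l^2-valued dyadic
martingale is bounded in L^p by the norm of the martingale
([square_function_bound]).  Applied to the family of all modulated f_k, first
in one variable and then in the other, it bounds the square function of all
pieces of all the f_k by that of the f_k.

Synthesis.  The pieces live on pairwise disjoint dyadic rectangles of
frequencies.  The projection P_s on such a rectangle is perfectly localised: it
commutes with the multiplication by a function that is constant on the cells of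
the dual size.  Let h >= 0 be a weight and let v dominate all averages of h over
dyadic rectangles.  Bessel's inequality for the restrictions of g to the level
sets of v gives
   sum_s int |P_s g|^2 h <= int |g|^2 v                ([tile_bessel_weighted])
and, by duality,
   int |sum_s F_s|^2 / v <= int (sum_s |F_s|^2) / h    ([tile_synthesis_weighted]).
For p < 2 take h = A^(2-p), where A dominates the square function of the pieces, and for v
an iterated maximal function of h.  Doob's inequality bounds v in L^(p/(2-p)),
an exponent above 1, and the L^p bound follows; for p = 2 constant weights do
([tile_synthesis_bound], [walsh_rectangles_bound]).

On the square, a Walsh polynomial is constant on dyadic cells of measure 4^-N
that exhaust the square up to a null set, so that the finite inequality becomes
one between integrals ([walsh_sum_bound]).  Approximation in L^2 by Walsh
polynomials gives finite families ([finite_family_bound]).  For a sequence, the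
finite case applied to windows of consecutive indices shows that the partial
sums are Cauchy in L^p; they converge by [Lp_complete], and the bound passes to
the limit. *)

(** * Inequalities between real powers *)
Section RealPowers.
Variable R : realType.
Implicit Types (a m p q r s t : R).

Lemma powR_le_npos m a q : 0 < m -> m <= a -> q <= 0 -> a `^ q <= m `^ q.
Proof.
move=> m0 ma q0; have a0 : 0 < a by exact: lt_le_trans ma.
rewrite -(opprK q) !(powRN _ (- q)) lef_pV2 ?posrE ?powR_gt0//.
by apply: ge0_ler_powR; rewrite ?oppr_ge0 ?nnegrE//; exact: ltW.
Qed.

Lemma powRD2 a p : 0 < a -> a ^+ 2 * a `^ (p - 2) = a `^ p.
Proof.
move=> a0; rewrite -powR_mulrn ?ltW// -powRD; last by rewrite (gt_eqF a0) implybT.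
by congr (_ `^ _); ring.
Qed.

(** This replaces Young's and Hoelder's inequalities below: bounds for the
integrals of a^2 m^(p-2) and of m^p give one for the integral of a^p.  Compare
a with m. *)
Lemma powR_le_weighted p a m : 0 <= p -> p <= 2 -> 0 < m -> 0 <= a ->
  a `^ p <= a ^+ 2 * m `^ (p - 2) + m `^ p.
Proof.
move=> p0 p2 m0 a0; have [am|ma] := leP a m.
  have : a `^ p <= m `^ p by apply: ge0_ler_powR; rewrite ?nnegrE// ltW.
  have : 0 <= a ^+ 2 * m `^ (p - 2) by rewrite mulr_ge0 ?powR_ge0 ?sqr_ge0.
  lra.
have a1 : 0 < a by exact: lt_trans ma.
rewrite -(powRD2 p a1) -[leLHS]addr0 lerD ?powR_ge0// ler_wpM2l ?sqr_ge0//.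
by apply: powR_le_npos => //; [exact: ltW | lra].
Qed.

(** By AM-GM, t^p + s^2 t^(p-2) = t^(p-2) (t^2 + s^2) >= 2 s t^(p-1) >= 2 s^p.
This is the pointwise step of the summation by parts in
[sum_avg_diff_weighted]. *)
Lemma powR_weight_gap p s t : 1 <= p -> p <= 2 -> 0 < s -> s <= t ->
  s ^+ 2 * (s `^ (p - 2) - t `^ (p - 2)) <= t `^ p - s `^ p.
Proof.
move=> p1 p2 s0 st; have t0 : 0 < t by exact: lt_le_trans st.
rewrite mulrBr powRD2// -(powRD2 p t0).
set w := t `^ (p - 2); have w0 : 0 < w by exact: powR_gt0.
have h1 : s * s `^ (p - 1) <= s * (t * w).
  rewrite ler_wpM2l ?(ltW s0)//; have -> : t * w = t `^ (p - 1).
    rewrite /w -{1}[t]powRr1 ?ltW// -powRD; last by rewrite (gt_eqF t0) implybT.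
    by congr (_ `^ _); ring.
  by apply: ge0_ler_powR; rewrite ?nnegrE ?(ltW s0) ?(ltW t0)//; lra.
rewrite mulr_powRB1 ?(ltW s0)// in h1; last lra.
have h2 : 0 <= w * (t - s) ^+ 2 by rewrite mulr_ge0 ?sqr_ge0 ?ltW.
nra.
Qed.

Lemma onemX_le (a : R) n : 0 <= a -> a <= 1 -> 1 - a ^+ n <= n%:R * (1 - a).
Proof.
move=> a0 a1; elim: n => [|n IH]; first by rewrite expr0; lra.
rewrite exprS -natr1; have : a ^+ n <= 1 by exact: exprn_ile1.
have := exprn_ge0 n a0; nra.
Qed.

(** After division by t^r the claim is 1 - a^(r/(r-1)) <= n (1 - a) with
a = (s/t)^(r-1) in [0, 1], and r/(r-1) <= n reduces it to an integer exponent.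
This is the pointwise step of Doob's inequality. *)
Lemma powR_gap n r s t : 1 < r -> r <= n%:R * (r - 1) -> 0 <= s -> s <= t ->
  t `^ r - s `^ r <= n%:R * (t `^ (r - 1) - s `^ (r - 1)) * t.
Proof.
move=> r1 rn s0 st; have [t0|t0] := eqVneq t 0.
  have -> : s = 0 by lra.
  by rewrite t0 !subrr mulr0.
have tp : 0 < t by rewrite lt_neqAle eq_sym t0; exact: le_trans st.
have n1 : 1 <= n%:R :> R.
  by rewrite ler1n lt0n; apply/eqP => n0; move: rn; rewrite n0 mul0r; lra.
pose u := s / t; have su : s = u * t by rewrite /u divfK.
have u0 : 0 <= u by rewrite divr_ge0// ltW.
have u1 : u <= 1 by rewrite ler_pdivrMr// mul1r.
have key : 1 - u `^ r <= n%:R * (1 - u `^ (r - 1)).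
  have [ue|un] := eqVneq u 0.
    by rewrite ue !powR0 ?subr0 ?mulr1//; apply/eqP; lra.
  have up : 0 < u by rewrite lt_neqAle eq_sym un.
  set a := u `^ (r - 1).
  have a0 : 0 <= a by exact: powR_ge0.
  have a1 : a <= 1.
    have -> : 1 = 1 `^ (r - 1) by rewrite powR1.
    by apply: ge0_ler_powR; rewrite ?nnegrE//; lra.
  apply: le_trans (onemX_le n a0 a1); rewrite lerD2l lerN2.
  rewrite -powR_mulrn// /a -powRrM; apply: ger_powR; first by rewrite up.
  by rewrite mulrC.
have ur x : (u * t) `^ x = u `^ x * t `^ x by rewrite powRM// ltW.
rewrite su !ur -(mulr_powRB1 (ltW tp) (_ : 0 < r)); last lra.
set w := t `^ (r - 1); have w0 : 0 <= w by exact: powR_ge0.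
have := ler_wpM2l (mulr_ge0 (ltW tp) w0) key; lra.
Qed.

End RealPowers.

(** * Averages over commuting involutions *)
Section Averages.
Variables (R : realType) (I : eqType) (T : finType) (th : I -> T -> T).
Hypothesis thK : forall i, involutive (th i).
Hypothesis thC : forall i j x, th i (th j x) = th j (th i x).
Implicit Types (f g h : T -> R) (l : seq I).

Definition flip_avg i f x := (f x + f (th i x)) / 2.

(** [avg l] is the conditional expectation on the functions that are invariant
under the involutions listed in [l]. *)
Definition avg l f := foldr flip_avg f l.

Definition flip_inv l f := forall i, i \in l -> forall x, f (th i x) = f x.

Lemma avg_cat l l' f : avg (l ++ l') f = avg l (avg l' f).
Proof. by rewrite /avg foldr_cat. Qed.

Lemma sum_flip i f : \sum_x f (th i x) = \sum_x f x.
Proof. by rewrite [RHS](reindex_inj (can_inj (thK i))). Qed.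

Lemma eq_avg l f g : f =1 g -> avg l f =1 avg l g.
Proof. by elim: l => //= i l IH fg x; rewrite /flip_avg !IH. Qed.

Lemma avg_flip i l f x : avg l f (th i x) = avg l (f \o th i) x.
Proof.
elim: l f x => //= j l IH f x.
by rewrite /flip_avg -IH -IH thC.
Qed.

Lemma flip_inv_avg l f : flip_inv l (avg l f).
Proof.
elim: l f => //= j l IH f i; rewrite inE /flip_avg => /orP[/eqP->|il] x.
  by rewrite thK addrC.
by rewrite (thC j i) !(IH f i il).
Qed.

Lemma avgMl l f g x : flip_inv l f ->
  avg l (fun x => f x * g x) x = f x * avg l g x.
Proof.
elim: l x => //= i l IH x h; rewrite /flip_avg !IH.
- by rewrite (h i) ?mem_head//; field.
- by move=> j jl; apply: h; rewrite inE jl orbT.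
- by move=> j jl; apply: h; rewrite inE jl orbT.
Qed.

Lemma avg1 l x : avg l (fun=> 1) x = 1.
Proof. by elim: l x => //= i l IH x; rewrite /flip_avg !IH; field. Qed.

Lemma avg_id l f : flip_inv l f -> avg l f =1 f.
Proof.
move=> h x; rewrite -[RHS]mulr1 -(avg1 l x) -avgMl//.
by apply: eq_avg => y; rewrite mulr1.
Qed.

Lemma avg_le l f g : (forall x, f x <= g x) -> forall x, avg l f x <= avg l g x.
Proof.
move=> fg; elim: l => //= i l IH x; rewrite /flip_avg ler_wpM2r ?invr_ge0//.
by rewrite lerD.
Qed.

Lemma avg_ge0 l f : (forall x, 0 <= f x) -> forall x, 0 <= avg l f x.
Proof.
move=> f0; elim: l => //= i l IH x; rewrite /flip_avg.
by rewrite mulr_ge0 ?addr_ge0 ?invr_ge0.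
Qed.

Lemma avg_gt0 l f : (forall x, 0 < f x) -> forall x, 0 < avg l f x.
Proof.
move=> f0; elim: l => //= i l IH x; rewrite /flip_avg.
by rewrite mulr_gt0 ?addr_gt0 ?invr_gt0.
Qed.

Lemma avg_sum (K : Type) (s : seq K) (P : pred K) l (F : K -> T -> R) x :
  avg l (fun x => \sum_(k <- s | P k) F k x) x =
  \sum_(k <- s | P k) avg l (F k) x.
Proof.
elim: l x => //= i l IH x; rewrite /flip_avg !IH -big_split/= mulr_suml.
by [].
Qed.

Lemma avgZ (c : R) l f x : avg l (fun x => c * f x) x = c * avg l f x.
Proof. exact: (avgMl (f := fun=> c)). Qed.

Lemma avg_comm l l' f : avg l (avg l' f) =1 avg l' (avg l f).
Proof.
elim: l f => //= i l IH f x; rewrite /flip_avg (IH f x) (IH f (th i x)).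
have -> : avg l' (flip_avg i (avg l f)) x =
    avg l' (fun y => 2^-1 * \sum_(b : bool) (if b then avg l f else avg l f \o th i) y) x.
  by apply: eq_avg => y; rewrite big_bool /flip_avg mulrC.
by rewrite avgZ avg_sum big_bool /= -avg_flip mulrC.
Qed.

(** Each half-sum over an involution is self-adjoint, and they commute. *)
Lemma sum_avg_adj l f g : \sum_x avg l f x * g x = \sum_x f x * avg l g x.
Proof.
elim: l f g => //= i l IH f g.
have flipadj u v : \sum_x flip_avg i u x * v x = \sum_x u x * flip_avg i v x.
  rewrite /flip_avg.
  under eq_bigr do rewrite mulrAC mulrDl mulrDl.
  under [RHS]eq_bigr do rewrite mulrA mulrDr mulrDl.
  rewrite !big_split/=; congr (_ + _).
  rewrite -(sum_flip i (fun x => u x * v (th i x) / 2)).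
  by under [RHS]eq_bigr do rewrite thK.
rewrite flipadj IH; apply: eq_bigr => x _; congr (_ * _).
exact: (avg_comm l [:: i]).
Qed.

Lemma sum_avg_inv l f g : flip_inv l g ->
  \sum_x avg l f x * g x = \sum_x f x * g x.
Proof. by move=> h; rewrite sum_avg_adj; under eq_bigr do rewrite avg_id//. Qed.

(** The Euclidean norm of an average is at most the average of the norms.  An
upper bound [B] for the norms is used in place of the norms themselves: being
positive it can be divided by. *)
Lemma le_avg_sum_sqr (K : finType) l (F : K -> T -> R) (B : T -> R) :
  (forall x, 0 < B x) -> (forall x, \sum_k F k x ^+ 2 <= B x ^+ 2) ->
  forall x, \sum_k avg l (F k) x ^+ 2 <= avg l B x ^+ 2.
Proof.
move=> B0 FB; elim: l => //= i l IH x; rewrite /flip_avg.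
set y := th i x; have bx := avg_gt0 l B0 x; have by_ := avg_gt0 l B0 y.
set b := avg l B x in bx *; set b' := avg l B y in by_ *.
(* Cauchy-Schwarz for the cross terms, in the form of weighted AM-GM *)
have cross k : ((avg l (F k) x + avg l (F k) y) / 2) ^+ 2 <=
    (avg l (F k) x ^+ 2 * (1 + b' / b) + avg l (F k) y ^+ 2 * (1 + b / b')) / 4.
  set u := avg l _ x; set v := avg l _ y.
  have -> : (u ^+ 2 * (1 + b' / b) + v ^+ 2 * (1 + b / b')) / 4 =
    ((u + v) / 2) ^+ 2 + (b' * u - b * v) ^+ 2 / (4 * b * b').
    by field; rewrite !gt_eqF.
  by rewrite lerDl divr_ge0 ?sqr_ge0// !mulr_ge0// ltW.
apply: le_trans (ler_sum _ (fun k _ => cross k)) _.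
rewrite -mulr_suml big_split/= -!mulr_suml.
have -> : ((b + b') / 2) ^+ 2 =
  (b ^+ 2 * (1 + b' / b) + b' ^+ 2 * (1 + b / b')) / 4.
  by field; rewrite !gt_eqF.
by rewrite ler_wpM2r ?invr_ge0// lerD// ler_wpM2r ?IH// addr_ge0 ?divr_ge0 ?ltW.
Qed.

End Averages.


(** * Doob's maximal inequality *)
Section Filtration.
Variables (R : realType) (I : eqType) (T : finType) (th : I -> T -> T).
Hypothesis thK : forall i, involutive (th i).
Hypothesis thC : forall i j x, th i (th j x) = th j (th i x).
Variable c : nat -> I.
Implicit Types (f B : T -> R) (d e n : nat) (p r : R).

(** The involutions are listed from the finest to the coarsest one, so that
[avg th (prefix d)] is coarser when [d] is larger, and the running maximum
[max_avg n d] of the averages of depth [d], ..., [d + n - 1] is measurable at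
depth [d]. *)
Fixpoint prefix d : seq I := if d is e.+1 then c e :: prefix e else [::].

Fixpoint max_avg n d f x : R :=
  if n is m.+1 then Num.max (avg th (prefix d) f x) (max_avg m d.+1 f x) else 0.

Definition avg_diff d f x : R :=
  (avg th (prefix d) f x - avg th (prefix d) f (th (c d) x)) / 2.

Lemma max_avg_ge0 n d f x : 0 <= max_avg n d f x.
Proof. by elim: n d => //= n IH d; rewrite le_max IH orbT. Qed.

Lemma le_max_avg n d e f x : (d <= e < d + n)%N ->
  avg th (prefix e) f x <= max_avg n d f x.
Proof.
elim: n d => [|n IH] d /=; first by rewrite addn0 leqNgt => /andP[/negP].
rewrite leq_eqVlt addnS -addSn => /andP[/orP[/eqP->|de] en]; rewrite le_max ?lexx//.
by rewrite IH ?orbT// de.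
Qed.

Lemma flip_inv_max_avg n d f : flip_inv th (prefix d) (max_avg n d f).
Proof.
elim: n d => [|n IH] d i id x //=; congr Num.max.
  exact: flip_inv_avg id x.
by apply: IH; rewrite inE id orbT.
Qed.

Lemma max_avg_gt0 n d f x : (forall x, 0 < f x) -> 0 < max_avg n.+1 d f x.
Proof. by move=> f0; rewrite /= lt_max avg_gt0. Qed.

(** Let M be the maximum over the depths >= d and M' the one over the depths
> d.  Where M > M', the average a of depth d equals M, so [powR_gap] gives
M^r - M'^r <= m (M^(r-1) - M'^(r-1)) a.  The weight in front of a is measurable
at depth d, so a may be replaced by f in the sum, and the induction
telescopes. *)
Lemma doob_weak (m : nat) r n d f : 1 < r -> r <= m%:R * (r - 1) ->
  (forall x, 0 <= f x) ->
  \sum_x max_avg n d f x `^ r <= m%:R * \sum_x max_avg n d f x `^ (r - 1) * f x.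
Proof.
move=> r1 rm f0; elim: n d => [|n IH] d.
  rewrite /= big1 ?mulr_ge0 ?sumr_ge0// => x _; first by rewrite mulr_ge0 ?powR_ge0.
  by rewrite powR0// gt_eqF// (lt_trans ltr01).
pose M' := max_avg n d.+1 f; pose M := max_avg n.+1 d f.
have M'0 x : 0 <= M' x by exact: max_avg_ge0.
have step x : M x `^ r <=
    M' x `^ r + m%:R * (avg th (prefix d) f x * (M x `^ (r - 1) - M' x `^ (r - 1))).
  rewrite /M /= -/(M' x); have [aM|Ma] := leP (avg th (prefix d) f x) (M' x).
    by rewrite subrr !mulr0 addr0.
  have := powR_gap r1 rm (M'0 x) (ltW Ma); lra.
apply: le_trans (ler_sum _ (fun x _ => step x)) _.
rewrite big_split/= -mulr_sumr sum_avg_inv//; last first.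
  move=> i id x; congr (_ `^ _ - _ `^ _); first exact: flip_inv_max_avg id x.
  by apply: flip_inv_max_avg; rewrite inE id orbT.
rewrite -lerBrDr; apply: le_trans (IH d.+1) _.
rewrite -mulrBr ler_wpM2l// -sumrB ler_sum// => x _.
rewrite -/(M' x) -/(M x); set a := _ `^ _; set b := _ `^ _; lra.
Qed.

End Filtration.

(** Young's inequality in the crude form that follows from comparing b with
eta a. *)
Lemma powR_young (R : realType) (eta a b r : R) :
  0 < eta -> 1 < r -> 0 <= a -> 0 <= b ->
  a `^ (r - 1) * b <= eta * a `^ r + eta^-1 `^ (r - 1) * b `^ r.
Proof.
move=> e0 r1 a0 b0.
have r0 : 0 < r by lra.
rewrite -(mulr_powRB1 a0 r0) -(mulr_powRB1 b0 r0).
have [ba|ab] := leP b (eta * a).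
  have := powR_ge0 a (r - 1); have := powR_ge0 b (r - 1).
  have := powR_ge0 eta^-1 (r - 1); set u := a `^ _; set v := b `^ _; set w := _ `^ _.
  move=> w0 v0 u0; have : 0 <= w * (b * v) by rewrite !mulr_ge0.
  have : u * b <= u * (eta * a) by rewrite ler_wpM2l.
  lra.
have : a `^ (r - 1) <= (eta^-1 * b) `^ (r - 1).
  apply: ge0_ler_powR; rewrite ?nnegrE ?mulr_ge0 ?invr_ge0 ?(ltW e0)//; first lra.
  by rewrite ler_pdivlMl// ltW.
rewrite powRM ?invr_ge0 ?(ltW e0)//.
move=> /(ler_wpM2r b0); have := powR_ge0 a (r - 1).
set u := a `^ _; set v := b `^ _; set w := _ `^ _ => u0.
have : 0 <= eta * (a * u) by rewrite !mulr_ge0// ltW.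
lra.
Qed.

(** [doob_weak] and [powR_young], with eta so small that half of the left-hand
side can be absorbed. *)
Lemma doob (R : realType) (r : R) : 1 < r -> exists2 C : R, 0 < C &
  forall (I : eqType) (T : finType) (th : I -> T -> T),
    (forall i, involutive (th i)) ->
    (forall i j x, th i (th j x) = th j (th i x)) ->
  forall (c : nat -> I) (f : T -> R) n, (forall x, 0 <= f x) ->
  \sum_x max_avg th c n 0 f x `^ r <= C * \sum_x f x `^ r.
Proof.
move=> r1; pose m := (Num.truncn (r / (r - 1))).+1.
have r10 : 0 < r - 1 by lra.
have rm : r <= m%:R * (r - 1).
  by rewrite -ler_pdivrMr// ltW// truncnS_gt.
have m0 : 0 < m%:R :> R by rewrite ltr0n.
(* m times e is one half, which is what gets absorbed *)
pose e : R := (2 * m%:R)^-1; have e0 : 0 < e by rewrite invr_gt0 mulr_gt0.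
exists (2 * m%:R * e^-1 `^ (r - 1)).
  by rewrite !mulr_gt0// powR_gt0// invr_gt0.
move=> I T th thK thC c f n f0.
have := doob_weak thK thC c n 0 r1 rm f0.
set M := max_avg th c n 0 f; set S := \sum_x M x `^ r => SM.
have : \sum_x M x `^ (r - 1) * f x <= e * S + e^-1 `^ (r - 1) * \sum_x f x `^ r.
  rewrite !mulr_sumr -big_split; apply: ler_sum => x _ /=.
  by apply: powR_young => //; exact: max_avg_ge0.
move=> /(ler_wpM2l (ltW m0)) /(le_trans SM).
have -> : m%:R * (e * S + e^-1 `^ (r - 1) * \sum_x f x `^ r) =
   S / 2 + m%:R * (e^-1 `^ (r - 1)) * \sum_x f x `^ r.
  by rewrite /e; field; rewrite gt_eqF.
lra.
Qed.

(** * The martingale square function *)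
Section SquareFunction.
Variables (R : realType) (I : eqType) (T : finType) (th : I -> T -> T).
Hypothesis thK : forall i, involutive (th i).
Hypothesis thC : forall i j x, th i (th j x) = th j (th i x).
Variable c : nat -> I.
Variables (K : finType) (F : K -> T -> R) (B : T -> R) (p : R).
Hypotheses (p1 : 1 < p) (p2 : p <= 2).
Hypotheses (B0 : forall x, 0 < B x) (FB : forall x, \sum_k F k x ^+ 2 <= B x ^+ 2).

Local Notation E d := (avg th (prefix c d)).
Local Notation M n d := (max_avg th c n d B).
Let X d x := \sum_k E d (F k) x ^+ 2.
Let Q d x := \sum_k avg_diff th c d (F k) x ^+ 2.

Let sqr_split d x : Q d x + X d.+1 x = flip_avg th (c d) (X d) x.
Proof.
rewrite /Q /X /flip_avg -!big_split/= mulr_suml; apply: eq_bigr => k _.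
by rewrite /avg_diff /flip_avg; field.
Qed.

Let X_le d x : X d x <= E d B x ^+ 2.
Proof. exact: le_avg_sum_sqr. Qed.

(** With X_d = sum_k |avg_d F_k|^2 one has sum Q_d W = sum (X_d - X_(d+1)) W for
every weight W measurable at depth d + 1.  The weights M_(d+1)^(p-2) are of this
kind because M_(d+1) only involves the depths > d; the sum over d is then a
summation by parts, whose error terms are controlled by [powR_weight_gap] and
X_d <= 4 M_(d+1)^2. *)
Lemma sum_avg_diff_weighted n d :
  \sum_x (\sum_(i < n) Q (d + i) x) * M n.+1 d x `^ (p - 2) <=
  \sum_x (X d x * M n.+1 d x `^ (p - 2) + 4 * M n.+1 d x `^ p).
Proof.
elim: n d => [|n IH] d.
  apply: ler_sum => x _; rewrite big_ord0 mul0r addr_ge0// mulr_ge0 ?powR_ge0//.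
  by rewrite sumr_ge0// => k _; rewrite sqr_ge0.
pose W' x := M n.+1 d.+1 x `^ (p - 2); pose W x := M n.+2 d x `^ (p - 2).
have M'0 x : 0 < M n.+1 d.+1 x by exact: max_avg_gt0.
have MM' x : M n.+1 d.+1 x <= M n.+2 d x by rewrite /= le_max lexx orbT.
have WW' x : W x <= W' x by apply: powR_le_npos; [exact: M'0 | exact: MM' | rewrite subr_le0].
have Q0 i x : 0 <= Q i x by rewrite sumr_ge0// => k _; rewrite sqr_ge0.
have step1 : \sum_x (\sum_(i < n.+1) Q (d + i) x) * W x <=
    \sum_x Q d x * W' x + \sum_x (\sum_(i < n) Q (d.+1 + i) x) * W' x.
  rewrite -big_split ler_sum// => x _ /=; rewrite -mulrDl.
  have -> : \sum_(i < n.+1) Q (d + i) x = Q d x + \sum_(i < n) Q (d.+1 + i) x.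
    rewrite big_ord_recl addn0; congr (_ + _); apply: eq_bigr => i _.
    by rewrite lift0 addnS.
  apply: ler_wpM2l (WW' x); apply: addr_ge0; first exact: Q0.
  by apply: sumr_ge0 => i _; exact: Q0.
have QW : \sum_x Q d x * W' x = \sum_x X d x * W' x - \sum_x X d.+1 x * W' x.
  apply/eqP; rewrite eq_sym subr_eq -big_split/=.
  rewrite -(sum_avg_inv thK thC (l := [:: c d]) (X d)); last first.
    move=> i; rewrite inE => /eqP-> x; congr (_ `^ _).
    by apply: flip_inv_max_avg => //=; rewrite mem_head.
  by apply/eqP/eq_bigr => x _; rewrite -mulrDl sqr_split.
apply: le_trans step1 _; rewrite QW.
have := IH d.+1; rewrite -/(W' _) => IH'.
apply: (@le_trans _ _ (\sum_x X d x * W' x + \sum_x 4 * M n.+1 d.+1 x `^ p)).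
  by move: IH'; rewrite [leRHS]big_split/=; set a := \sum_x X d.+1 x * _; rewrite /W' -/a; lra.
rewrite -big_split; apply: ler_sum => x _ /=.
rewrite -/(M n.+2 d x) -/(W x).
have gap := powR_weight_gap (ltW p1) p2 (M'0 x) (MM' x).
rewrite -/(W x) -/(W' x) in gap.
have b1 : E d B x <= 2 * E d.+1 B x.
  rewrite /= /flip_avg mulrC divfK//; have := avg_gt0 th (prefix c d) B0 (th (c d) x).
  lra.
have b2 : E d.+1 B x <= M n.+1 d.+1 x by apply: le_max_avg; rewrite leqnn addnS ltnS leq_addr.
have Xd : X d x <= 4 * M n.+1 d.+1 x ^+ 2.
  have := X_le d x; have := avg_gt0 th (prefix c d) B0 x; nra.
have := WW' x; nra.
Qed.

Lemma sum_square_weighted N :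
  \sum_x (\sum_(i < N) Q i x) * M N.+1 0 x `^ (p - 2) <= 5 * \sum_x M N.+1 0 x `^ p.
Proof.
apply: le_trans (sum_avg_diff_weighted N 0) _; rewrite mulr_sumr ler_sum// => x _.
have M0 : 0 < M N.+1 0 x by exact: max_avg_gt0.
have : X 0 x * M N.+1 0 x `^ (p - 2) <= M N.+1 0 x ^+ 2 * M N.+1 0 x `^ (p - 2).
  rewrite ler_wpM2r ?powR_ge0//; apply: le_trans (X_le 0 x) _.
  rewrite ler_sqr ?nnegrE ?avg_ge0 ?(ltW M0)//; last by move=> y; exact: ltW.
  by apply: le_max_avg; rewrite add0n.
rewrite powRD2//; lra.
Qed.

End SquareFunction.

(** The bounding function is the square root of Q + M^2, with Q the square
function and M the maximal function of [B]: adding M^2 makes it positive, so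
that the lemma can be iterated in the second variable. *)
Lemma square_function_bound (R : realType) (p : R) : 1 < p -> p <= 2 ->
  exists2 C : R, 0 < C &
  forall (I : eqType) (T : finType) (th : I -> T -> T),
    (forall i, involutive (th i)) ->
    (forall i j x, th i (th j x) = th j (th i x)) ->
  forall (c : nat -> I) (K : finType) (F : K -> T -> R) (B : T -> R) N,
    (forall x, 0 < B x) -> (forall x, \sum_k F k x ^+ 2 <= B x ^+ 2) ->
  exists B1 : T -> R, [/\ forall x, 0 < B1 x,
    forall x, \sum_(kd : K * 'I_N) avg_diff th c kd.2 (F kd.1) x ^+ 2 <= B1 x ^+ 2
    & \sum_x B1 x `^ p <= C * \sum_x B x `^ p].
Proof.
move=> p1 p2; have [C C0 Cdoob] := doob p1.
exists (7 * C) => [|I T th thK thC c K F B N B0 FB]; first by rewrite mulr_gt0.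
pose M := max_avg th c N.+1 0 B.
have M0 x : 0 < M x by exact: max_avg_gt0.
pose Q x := \sum_(i < N) \sum_k avg_diff th c i (F k) x ^+ 2.
have Q0 x : 0 <= Q x by do 2 rewrite sumr_ge0// => ? _; rewrite sqr_ge0.
have QM x : 0 < Q x + M x ^+ 2 by rewrite ltr_wpDl// exprn_gt0.
have sq x : Num.sqrt (Q x + M x ^+ 2) ^+ 2 = Q x + M x ^+ 2.
  by rewrite sqr_sqrtr// ltW.
exists (fun x => Num.sqrt (Q x + M x ^+ 2)); split.
- by move=> x; rewrite sqrtr_gt0.
- move=> x; rewrite sq.
  rewrite -(pair_bigA _ (fun k (i : 'I_N) => avg_diff th c i (F k) x ^+ 2)).
  rewrite exchange_big/= -/(Q x).
  by rewrite lerDl sqr_ge0.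
have step : \sum_x Num.sqrt (Q x + M x ^+ 2) `^ p <= 7 * \sum_x M x `^ p.
  have := sum_square_weighted thK thC c p1 p2 B0 FB N; rewrite -/M => h.
  apply: (@le_trans _ _ (\sum_x Q x * M x `^ (p - 2) + 2 * \sum_x M x `^ p)).
    rewrite mulr_sumr -big_split ler_sum// => x _ /=.
    have : 0 <= p by lra.
    move=> /powR_le_weighted/(_ p2 (M0 x) (sqrtr_ge0 (Q x + M x ^+ 2))).
    rewrite sq mulrDl powRD2//; lra.
  by move: h; rewrite -/Q; lra.
apply: le_trans step _; rewrite -mulrA ler_wpM2l//.
by apply: Cdoob => // x; exact: ltW.
Qed.


(** * Weighted inequalities for tiles *)
Section LayerCake.
Variables (R : realType) (A A' : finType) (b c : A -> R) (b' c' : A' -> R).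
Hypothesis tails :
  forall lam, \sum_(a | lam <= c a) b a <= \sum_(a | lam <= c' a) b' a.

Let pos_part (t x : R) := Num.max (t - x) 0.

Let pos_part_split x y s t : x <= y -> path <=%R y s -> t <= x \/ t \in y :: s ->
  pos_part t x = pos_part t y + (y - x) * (y <= t)%R%:R.
Proof.
move=> xy ys tv; have [yt|ty] := leP y t.
  rewrite /pos_part mulr1 !max_l ?subr_ge0//; first by ring.
  exact: le_trans yt.
have tx : t <= x.
  case: tv => // /predU1P[te|ts]; first by move: ty; rewrite te ltxx.
  by move: ys => /(order_path_min le_trans)/allP/(_ _ ts); rewrite leNgt ty.
rewrite /pos_part mulr0 addr0 !max_r// subr_le0// ltW//.
Qed.

Let layer_cake_from s x : path <=%R x s ->
  (forall a, c a <= x \/ c a \in s) -> (forall a, c' a <= x \/ c' a \in s) ->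
  \sum_a b a * pos_part (c a) x <= \sum_a b' a * pos_part (c' a) x.
Proof.
elim: s x => [|y s IH] x /= xs cs cs'.
  rewrite !big1// => a _.
    by case: (cs' a) => // h; rewrite /pos_part max_r ?mulr0// subr_le0.
  by case: (cs a) => // h; rewrite /pos_part max_r ?mulr0// subr_le0.
move: xs => /andP[xy ys].
have next t : t <= x \/ t \in y :: s -> t <= y \/ t \in s.
  by case=> [/le_trans/(_ xy)|/predU1P[->|]]; [left|left|right].
under eq_bigr do rewrite (pos_part_split xy ys (cs _)) mulrDr mulrCA.
under [leRHS]eq_bigr do rewrite (pos_part_split xy ys (cs' _)) mulrDr mulrCA.
rewrite !big_split/= -!mulr_sumr lerD//.
  by apply: IH => // a; exact: next.
have e (D : finType) (f g : D -> R) :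
    \sum_a f a * (y <= g a)%R%:R = \sum_(a | y <= g a) f a.
  by rewrite [RHS]big_mkcond/=; apply: eq_bigr => a _; case: ifP; rewrite ?mulr1 ?mulr0.
by rewrite !e ler_wpM2l ?subr_ge0.
Qed.

(** Integrating the hypothesis over the level lam would prove this; as there
are finitely many levels, induction on their sorted list does. *)
Lemma layer_cake : (forall a, 0 <= c a) -> (forall a, 0 <= c' a) ->
  \sum_a b a * c a <= \sum_a b' a * c' a.
Proof.
move=> c0 c0'; pose s := sort <=%R ([seq c a | a : A] ++ [seq c' a | a : A']).
have sp : path <=%R 0 s.
  rewrite path_min_sorted ?sort_sorted//; first exact: le_total.
  by apply/allP => t; rewrite mem_sort mem_cat => /orP[] /mapP[a _ ->].
have h := @layer_cake_from s 0 sp.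
have pE t : 0 <= t -> pos_part t 0 = t by move=> t0; rewrite /pos_part subr0 max_l.
under eq_bigr do rewrite -(pE (c _))//.
under [leRHS]eq_bigr do rewrite -(pE (c' _))//.
apply: h => a; right; rewrite mem_sort mem_cat; apply/orP.
  by left; apply: map_f; rewrite mem_enum.
by right; apply: map_f; rewrite mem_enum.
Qed.

End LayerCake.

Section Tiles.
Variables (R : realType) (I : eqType) (T : finType) (th : I -> T -> T).
Hypothesis thK : forall i, involutive (th i).
Hypothesis thC : forall i j x, th i (th j x) = th j (th i x).
Variables (S : finType) (sel : pred S) (l : S -> seq I) (chi : S -> T -> R).
Implicit Types (f g h v : T -> R) (s t : S).

(** The projection on the functions chi u, with u invariant under the flips in
[l s].  For a Walsh character chi these are the functions with spectrum in the
dyadic rectangle of the frequencies that agree with that of chi on the digits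
listed in [l s]. *)
Definition tile_proj s g x := chi s x * avg th (l s) (fun y => chi s y * g y) x.

Hypothesis chi2 : forall s x, chi s x ^+ 2 = 1.
Hypothesis orth : forall s t, sel s -> sel t -> s != t ->
  forall g, \sum_x tile_proj s g x * tile_proj t g x = 0.

Lemma tile_proj_adj s f g :
  \sum_x tile_proj s f x * g x = \sum_x f x * tile_proj s g x.
Proof.
under eq_bigr do rewrite /tile_proj mulrAC mulrC.
rewrite sum_avg_adj//; apply: eq_bigr => x _.
by rewrite /tile_proj mulrA; congr (_ * _); exact: mulrC.
Qed.

Lemma tile_proj_idem s g x : tile_proj s (tile_proj s g) x = tile_proj s g x.
Proof.
rewrite /tile_proj; congr (_ * _); rewrite -[RHS](avg_id (flip_inv_avg thK thC _)).
by apply: eq_avg => y; rewrite mulrA -expr2 chi2 mul1r.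
Qed.

Lemma eq_tile_proj s f g : f =1 g -> tile_proj s f =1 tile_proj s g.
Proof.
by move=> fg x; rewrite /tile_proj; congr (_ * _); apply: eq_avg => y; rewrite fg.
Qed.

Lemma tile_projMl s u g x : flip_inv th (l s) u ->
  tile_proj s (fun y => u y * g y) x = u x * tile_proj s g x.
Proof.
move=> us; rewrite /tile_proj mulrCA -(avgMl (f := u))//; congr (_ * _).
by apply: eq_avg => y; rewrite mulrCA.
Qed.

Lemma tile_proj_sqr_inv s g : flip_inv th (l s) (fun x => tile_proj s g x ^+ 2).
Proof.
move=> i il x; rewrite /tile_proj !exprMn !chi2.
by rewrite (flip_inv_avg thK thC _ il).
Qed.

Lemma tile_bessel g :
  \sum_(s | sel s) \sum_x tile_proj s g x ^+ 2 <= \sum_x g x ^+ 2.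
Proof.
pose G x := \sum_(s | sel s) tile_proj s g x.
have gG : \sum_x g x * G x = \sum_(s | sel s) \sum_x tile_proj s g x ^+ 2.
  under eq_bigr do rewrite mulr_sumr.
  rewrite exchange_big; apply: eq_bigr => s _ /=.
  rewrite -(eq_bigr _ (fun x _ => congr1 (fun y => g x * y) (tile_proj_idem s g x))).
  by rewrite -tile_proj_adj.
have GG : \sum_x G x ^+ 2 = \sum_(s | sel s) \sum_x tile_proj s g x ^+ 2.
  under eq_bigr do rewrite expr2 mulr_suml.
  rewrite exchange_big; apply: eq_bigr => s ss /=.
  under eq_bigr do rewrite mulr_sumr.
  rewrite exchange_big (bigD1 s)//= [X in _ + X]big1 ?addr0// => t /andP[ts st].
  by apply: orth; rewrite // eq_sym.
have : 0 <= \sum_x (g x - G x) ^+ 2 by rewrite sumr_ge0// => x _; rewrite sqr_ge0.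
under eq_bigr do rewrite sqrrB.
rewrite big_split sumrB/= GG sumrMnl gG; lra.
Qed.

(** By [layer_cake] it suffices to bound, for each level lam, the sum of
|P_s g|^2 over the points where the average of h is at least lam.  This set is a
union of cells on which P_s is localised, and it is contained in {v >= lam};
so there P_s g = P_s (g 1_{v >= lam}), and Bessel's inequality applies. *)
Lemma tile_bessel_weighted g h v : (forall x, 0 <= h x) ->
  (forall s x, sel s -> avg th (l s) h x <= v x) -> (forall x, 0 <= v x) ->
  \sum_(s | sel s) \sum_x tile_proj s g x ^+ 2 * avg th (l s) h x <=
  \sum_x g x ^+ 2 * v x.
Proof.
move=> h0 hv v0.
pose b (q : S * T) := if sel q.1 then tile_proj q.1 g q.2 ^+ 2 else 0.
have -> : \sum_(s | sel s) \sum_x tile_proj s g x ^+ 2 * avg th (l s) h x =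
    \sum_q b q * avg th (l q.1) h q.2.
  rewrite -(pair_bigA _ (fun s x => b (s, x) * avg th (l s) h x)) big_mkcond/=.
  apply: eq_bigr => s _; rewrite /b/=; case: ifP => // _.
  by rewrite big1// => x _; rewrite mul0r.
apply: layer_cake => [lam|[s x]|//]; last exact: avg_ge0.
pose U x : R := (lam <= v x)%R%:R.
have gU : \sum_(x | lam <= v x) g x ^+ 2 = \sum_x (g x * U x) ^+ 2.
  rewrite big_mkcond; apply: eq_bigr => x _; rewrite /U.
  by case: ifP => _; rewrite ?mulr1// mulr0 expr0n.
rewrite gU; apply: le_trans (tile_bessel _).
have bound q : (if lam <= avg th (l q.1) h q.2 then b q else 0) <=
    (if sel q.1 then tile_proj q.1 (fun x => g x * U x) q.2 ^+ 2 else 0).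
  case: q => s x; rewrite /b/=; case: (boolP (sel s)) => // ss; last by rewrite if_same.
  case: ifPn => [lx|_]; last exact: sqr_ge0.
  pose u x : R := (lam <= avg th (l s) h x)%R%:R.
  have us : flip_inv th (l s) u.
    by move=> i il y; rewrite /u (flip_inv_avg thK thC _ il).
  have ux : u x = 1 by rewrite /u lx.
  rewrite -[tile_proj s g x]mul1r -ux -tile_projMl//.
  rewrite -[X in _ <= X ^+ 2]mul1r -ux -tile_projMl//.
  rewrite le_eqVlt; apply/orP; left; apply/eqP; congr (_ ^+ 2).
  apply: eq_tile_proj => y; rewrite /u /U; case: (leP lam _) => [ly|_]; last by rewrite !mul0r.
  by rewrite (le_trans ly (hv _ _ ss)) mulr1.
rewrite big_mkcond/=; apply: le_trans (ler_sum _ (fun q _ => bound q)) _.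
rewrite -(pair_bigA _ (fun s x => if sel s then tile_proj s (fun x => g x * U x) x ^+ 2 else 0)).
rewrite [leRHS]big_mkcond/=; apply: ler_sum => s _; case: ifP => // _.
by rewrite big1.
Qed.

(** Jensen's inequality for the convex function 1/t. *)
Lemma avg_inv_le f s x : (forall y, 0 < f y) ->
  (avg th (l s) f x)^-1 <= avg th (l s) (fun y => (f y)^-1) x.
Proof.
move=> f0; pose m y := avg th (l s) f y.
have m0 y : 0 < m y by exact: avg_gt0.
have mi : flip_inv th (l s) (fun y => (m y)^-1).
  by move=> i il y; rewrite /m (flip_inv_avg thK thC _ il).
have mi2 : flip_inv th (l s) (fun y => (m y)^-2).
  by move=> i il y; rewrite /m (flip_inv_avg thK thC _ il).
(* The tangent line of the convex function 1/t at t = m *)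
have tangent y : \sum_(k : bool) (if k then (m y)^-1 * 2 else (m y)^-2 * - f y) <= (f y)^-1.
  rewrite big_bool/=.
  have -> : (f y)^-1 = (m y)^-1 * 2 + (m y)^-2 * - f y + (f y - m y) ^+ 2 / (f y * m y ^+ 2).
    by field; rewrite !gt_eqF.
  by rewrite lerDl divr_ge0 ?sqr_ge0// mulr_ge0 ?sqr_ge0// ltW.
apply: le_trans (avg_le _ _ tangent x).
rewrite (avg_sum _ _ _ _ (fun (k : bool) y => if k then (m y)^-1 * 2 else (m y)^-2 * - f y)).
rewrite big_bool/= !avgMl// (avg_id (f := fun=> 2))//.
have -> : avg th (l s) (fun y => - f y) x = - m x.
  by rewrite -mulN1r /m -avgZ; apply: eq_avg => y; rewrite mulN1r.
rewrite -/(m x) le_eqVlt; apply/orP; left; apply/eqP.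
by field; rewrite gt_eqF.
Qed.

(** With G = sum_s F_s, test G against g = G / v.  The pairing is
sum_s <F_s, P_s g>; AM-GM with the average of h as weight and
[tile_bessel_weighted] leave sum_s int F_s^2 / avg h.  As F_s^2 is constant on
the cells, [avg_inv_le] turns 1 / avg h into 1 / h. *)
Lemma tile_synthesis_weighted (F : S -> T -> R) h v :
  (forall s, sel s -> tile_proj s (F s) =1 F s) ->
  (forall x, 0 < h x) -> (forall x, 0 < v x) ->
  (forall s x, sel s -> avg th (l s) h x <= v x) ->
  \sum_x (\sum_(s | sel s) F s x) ^+ 2 / v x <=
  \sum_x (\sum_(s | sel s) F s x ^+ 2) / h x.
Proof.
move=> PF h0 v0 hv.
pose G x := \sum_(s | sel s) F s x; pose g x := G x / v x.
pose E s x := avg th (l s) h x.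
have E0 s x : 0 < E s x by exact: avg_gt0.
have pairing : \sum_x G x * g x = \sum_(s | sel s) \sum_x F s x * tile_proj s g x.
  under eq_bigr do rewrite mulr_suml.
  rewrite exchange_big; apply: eq_bigr => s ss /=.
  by rewrite -tile_proj_adj; apply: eq_bigr => x _; rewrite PF.
have amgm s x : 2 * (F s x * tile_proj s g x) <=
    F s x ^+ 2 / E s x + tile_proj s g x ^+ 2 * E s x.
  set a := F s x; set b := tile_proj s g x; have e0 := E0 s x; set e := E s x in e0 *.
  have -> : a ^+ 2 / e + b ^+ 2 * e = 2 * (a * b) + (a - b * e) ^+ 2 / e.
    by field; rewrite gt_eqF.
  by rewrite lerDl divr_ge0 ?sqr_ge0// ltW.
have sums : 2 * \sum_x G x * g x <=
    \sum_(s | sel s) \sum_x F s x ^+ 2 / E s x + \sum_x G x * g x.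
  rewrite {1}pairing.
  have -> : \sum_x G x * g x = \sum_x g x ^+ 2 * v x.
    by apply: eq_bigr => x _; rewrite /g; field; rewrite gt_eqF.
  have := tile_bessel_weighted g (fun x => ltW (h0 x)) hv (fun x => ltW (v0 x)).
  move=> /(lerD (lexx (\sum_(s | sel s) \sum_x F s x ^+ 2 / E s x))).
  apply: le_trans; rewrite mulr_sumr -big_split ler_sum// => s _ /=.
  by rewrite mulr_sumr -big_split ler_sum.
have -> : \sum_x G x ^+ 2 / v x = \sum_x G x * g x.
  by apply: eq_bigr => x _; rewrite expr2 mulrA.
apply: (@le_trans _ _ (\sum_(s | sel s) \sum_x F s x ^+ 2 / E s x)); first by lra.
under [leRHS]eq_bigr do rewrite mulr_suml.
rewrite [leRHS]exchange_big; apply: ler_sum => s ss /=.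
have FI : flip_inv th (l s) (fun x => F s x ^+ 2).
  move=> i il x; rewrite -!(PF s ss); exact: tile_proj_sqr_inv il x.
apply: (@le_trans _ _ (\sum_x F s x ^+ 2 * avg th (l s) (fun y => (h y)^-1) x)).
  by apply: ler_sum => x _; rewrite ler_wpM2l ?sqr_ge0 ?avg_inv_le.
rewrite -sum_avg_adj// le_eqVlt; apply/orP; left; apply/eqP/eq_bigr => x _.
by rewrite avg_id.
Qed.

End Tiles.

(** The weight is h = A^(2-p), for which int A^2 / h = int A^p, and v is the
maximal function of h in one variable followed by the one in the other; it is
bounded in L^r with r = p / (2 - p) by a power of A in L^p.  For p = 2, where r
is infinite, constant weights do. *)
Lemma tile_synthesis_bound (R : realType) (p : R) : 1 < p -> p <= 2 ->
  exists2 C : R, 0 < C &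
  forall (I : eqType) (T : finType) (th : I -> T -> T),
    (forall i, involutive (th i)) ->
    (forall i j x, th i (th j x) = th j (th i x)) ->
  forall (c1 c2 : nat -> I) (N : nat) (S : finType) (sel : pred S)
    (d1 d2 : S -> nat) (chi : S -> T -> R),
  let l s := prefix c1 (d1 s) ++ prefix c2 (d2 s) in
  (forall s, (d1 s <= N)%N && (d2 s <= N)%N) ->
  (forall s x, chi s x ^+ 2 = 1) ->
  (forall s t, sel s -> sel t -> s != t ->
    forall g, \sum_x tile_proj th l chi s g x * tile_proj th l chi t g x = 0) ->
  forall (F : S -> T -> R) (A : T -> R),
  (forall s, sel s -> tile_proj th l chi s (F s) =1 F s) ->
  (forall x, 0 < A x) ->
  (forall x, \sum_(s | sel s) F s x ^+ 2 <= A x ^+ 2) ->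
  \sum_x `|\sum_(s | sel s) F s x| `^ p <= C * \sum_x A x `^ p.
Proof.
move=> p1 p2; have [pe|pn] := eqVneq p 2.
  exists 1 => // I T th thK thC c1 c2 N S sel d1 d2 chi l dN chi2 orth F A PF A0 FA.
  have h1 s x : sel s -> avg th (l s) (fun=> 1 : R) x <= 1 by rewrite avg1.
  have h := tile_synthesis_weighted thK thC chi2 orth PF (fun=> ltr01) (fun=> ltr01) h1.
  have pw a : 0 <= a -> a `^ p = a ^+ 2 by move=> a0; rewrite pe powR_mulrn.
  rewrite mul1r; under eq_bigr do rewrite pw// real_normK ?num_real//.
  under [leRHS]eq_bigr do rewrite pw ?(ltW (A0 _))//.
  apply: le_trans (ler_sum _ (fun x _ => FA x)).
  apply: le_trans (le_trans h _); apply: ler_sum => x _; by rewrite /= divr1.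
have {pn}p2 : p < 2 by rewrite lt_neqAle pn.
pose r := p / (2 - p).
have q0 : 0 < 2 - p by lra.
have r1 : 1 < r by rewrite /r ltr_pdivlMr//; lra.
have [C C0 Cdoob] := doob r1.
exists (1 + C * C) => [|I T th thK thC c1 c2 N S sel d1 d2 chi l dN chi2 orth F A PF A0 FA].
  by rewrite addr_gt0// mulr_gt0.
pose h x := A x `^ (2 - p).
have h0 x : 0 < h x by exact: powR_gt0.
pose M2 := max_avg th c2 N.+1 0 h; pose v := max_avg th c1 N.+1 0 M2.
have M20 x : 0 < M2 x by exact: max_avg_gt0.
have v0 x : 0 < v x by exact: max_avg_gt0.
have hv s x : sel s -> avg th (l s) h x <= v x.
  move=> _; have /andP[d1N d2N] := dN s; rewrite /l avg_cat.
  apply: (@le_trans _ _ (avg th (prefix c1 (d1 s)) M2 x)).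
    by apply: avg_le => y; apply: le_max_avg.
  by apply: le_max_avg.
have hp := tile_synthesis_weighted thK thC chi2 orth PF h0 v0 hv.
have vr : \sum_x v x `^ r <= C * C * \sum_x A x `^ p.
  have hA x : h x `^ r = A x `^ p.
    by rewrite /h -powRrM; congr (_ `^ _); rewrite /r mulrC divfK// gt_eqF.
  rewrite -(eq_bigr _ (fun x _ => hA x)) -mulrA.
  apply: le_trans (Cdoob _ _ _ thK thC c1 M2 N.+1 _) _ => [x|]; first exact: ltW.
  rewrite ler_wpM2l// ?(ltW C0)//.
  by apply: Cdoob => // x; exact: ltW.
have hA : \sum_x (\sum_(s | sel s) F s x ^+ 2) / h x <= \sum_x A x `^ p.
  apply: ler_sum => x _; rewrite -(powRD2 p (A0 x)).
  have -> : A x `^ (p - 2) = (h x)^-1 by rewrite /h -powRN opprB.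
  by rewrite ler_wpM2r ?invr_ge0 ?(ltW (h0 x)).
apply: (@le_trans _ _ (\sum_x (\sum_(s | sel s) F s x) ^+ 2 / v x + \sum_x v x `^ r)).
  rewrite -big_split; apply: ler_sum => x _ /=.
  pose m := v x `^ (2 - p)^-1.
  have m0 : 0 < m by exact: powR_gt0.
  have : 0 <= p by lra.
  move=> /powR_le_weighted/(_ (ltW p2) m0 (normr_ge0 (\sum_(s | sel s) F s x))).
  rewrite real_normK ?num_real// /m -!powRrM.
  have -> : (2 - p)^-1 * (p - 2) = -1 by field; rewrite gt_eqF.
  by rewrite powR_inv1 ?(ltW (v0 x))// [_^-1 * p]mulrC -/r.
rewrite mulrDl mul1r; lra.
Qed.


(** * Dyadic pieces of an interval of frequencies *)
Section DyadicBlocks.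
Implicit Types (n e i m N : nat).
Local Open Scope nat_scope.

Definition bit n k := odd (n %/ 2 ^ k).

Definition same_cell i n e := n %/ 2 ^ i == e %/ 2 ^ i.

(** The highest binary digit in which [n] and [e] differ is the [i]-th one, that
is, [n] belongs to e xor [2^i, 2^(i+1)). *)
Definition block e i n := ~~ same_cell i n e && same_cell i.+1 n e.

Lemma cellS n i : n %/ 2 ^ i.+1 = (n %/ 2 ^ i)./2.
Proof. by rewrite expnSr divnMA divn2. Qed.

Lemma same_cell_le i j n e : i <= j -> same_cell i n e -> same_cell j n e.
Proof.
by move=> /subnKC <-; rewrite /same_cell expnD !divnMA => /eqP->.
Qed.

Lemma same_cell_bit i k n e : i <= k -> same_cell i n e -> bit n k = bit e k.
Proof. by move=> ik /(same_cell_le ik)/eqP h; rewrite /bit h. Qed.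

Lemma same_cell_mid i x y z : x <= y -> y <= z -> same_cell i x z -> same_cell i y x.
Proof.
move=> xy yz /eqP h; rewrite /same_cell eqn_leq [in X in X && _]h.
by rewrite !leq_div2r.
Qed.

Lemma same_cell_bits N i n e : n < 2 ^ N -> e < 2 ^ N ->
  (forall k, i <= k < N -> bit n k = bit e k) -> same_cell i n e.
Proof.
move=> nN eN; have [m] := ubnP (N - i); elim: m i => // m IH i im h.
have [Ni|iN] := leqP N i.
  apply: (same_cell_le Ni); rewrite /same_cell !divn_small//.
have := IH i.+1; rewrite /same_cell !cellS => /(_ _ _)/eqP hh.
rewrite -(odd_double_half (n %/ _)) -[e %/ _]odd_double_half.
rewrite -!/(bit _ _) h ?leqnn// hh//; first by lia.
by move=> k /andP[ik kN]; apply: h; rewrite kN ltnW.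
Qed.

(** Membership of a piece is a condition on the digits from [i] on; these are
the ones that the flips of a tile can see. *)
Lemma block_bits N e (i : 'I_N) n : n < 2 ^ N -> e < 2 ^ N ->
  block e i n = [forall m : 'I_N, (i <= m) ==> (bit n m == bit e m (+) (m == i))].
Proof.
move=> nN eN; apply/andP/forallP => [[ne sc] m|h].
  apply/implyP; rewrite leq_eqVlt => /orP[/eqP im|im]; last first.
    rewrite (same_cell_bit im sc) -val_eqE/= gtn_eqF//.
    by rewrite addbF.
  have -> : m = i by exact/val_inj.
  rewrite eqxx addbT; move: ne sc; rewrite /same_cell !cellS /bit => ne /eqP sc.
  move: ne sc; set x := n %/ _; set y := e %/ _; lia.
split.
  have := h i; rewrite leqnn eqxx addbT /=; apply: contraL => /(same_cell_bit (leqnn i))->.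
  by case: bit.
apply: (same_cell_bits nN eN) => k /andP[ik kN].
have := h (Ordinal kN); rewrite /= (ltnW ik) -val_eqE/= gtn_eqF// addbF.
by move/eqP.
Qed.

Lemma block_exists N n e : n < 2 ^ N -> e < 2 ^ N -> n != e -> exists i : 'I_N, block e i n.
Proof.
move=> nN eN ne; have ex : exists i, same_cell i n e.
  by exists N; rewrite /same_cell !divn_small.
case: (ex_minnP ex) => -[|i] sc min.
  by move: sc ne; rewrite /same_cell !divn1 => ->.
have nsc : ~~ same_cell i n e by apply/negP => /min; rewrite ltnn.
have iN : i < N.
  rewrite ltnNge; apply: contra nsc => Ni; apply: (same_cell_le Ni).
  by rewrite /same_cell !divn_small.
by exists (Ordinal iN); rewrite /block nsc.
Qed.

Variables (N a b : nat).
Hypotheses (ab : a <= b) (bN : b < 2 ^ N).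

(** The two integers next to [a, b) on either side; for a = 0 the left one
is 0 itself, which [piece_sel] rejects as a point of [a, b). *)
Definition endpoint (t : bool) := if t then b else a.-1.

Definition piece (q : bool * 'I_N) n := block (endpoint q.1) q.2 n.

(** Selects the nonempty pieces contained in [a, b).  The parent of such a piece
contains an endpoint outside [a, b), so they are the maximal dyadic
subintervals of [a, b). *)
Definition piece_sel (q : bool * 'I_N) :=
  [&& ~~ (a <= endpoint q.1 < b),
      [forall n : 'I_(2 ^ N), piece q n ==> (a <= n < b)]
    & [exists n : 'I_(2 ^ N), piece q n]].

Lemma endpoint_lt t : endpoint t < 2 ^ N.
Proof. by case: t => //=; lia. Qed.

Lemma piece_sub q n : piece_sel q -> n < 2 ^ N -> piece q n -> a <= n < b.
Proof. by move=> /and3P[_ /forallP h _] nN; have /implyP := h (Ordinal nN); apply. Qed.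

Let no_middle (x y z : nat) : x < y -> y < z -> x./2 = y./2 -> y./2 = z./2 -> False.
Proof. lia. Qed.

Let cell_lt i x y : x <= y -> ~~ same_cell i x y -> x %/ 2 ^ i < y %/ 2 ^ i.
Proof. by move=> xy h; rewrite ltn_neqAle h leq_div2r. Qed.

Let ends_differ i n : a <= n < b -> 0 < a ->
  ~~ same_cell i n a.-1 -> ~~ same_cell i n b ->
  same_cell i.+1 n a.-1 -> same_cell i.+1 n b -> False.
Proof.
move=> /andP[an nb] a0 h1 h2; rewrite /same_cell !cellS => /eqP e1 /eqP e2.
apply: (@no_middle (a.-1 %/ 2 ^ i) (n %/ 2 ^ i) (b %/ 2 ^ i)) => //.
  by apply: cell_lt; [lia|rewrite /same_cell eq_sym].
by apply: cell_lt => //; lia.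
Qed.

(** Of two selected pieces through n, the larger one would contain the endpoint
of the smaller one, so they have the same length.  Were the endpoints
different, n would lie strictly between them, while the cells of the two
endpoints and of n are siblings: three cells do not fit into one parent. *)
Lemma piece_unique q q' n : a <= n < b -> piece_sel q -> piece_sel q' ->
  piece q n -> piece q' n -> q = q'.
Proof.
move=> nab.
have lt q1 q2 : piece_sel q1 -> piece_sel q2 -> piece q1 n -> piece q2 n ->
    q1.2 <= q2.2.
  move=> s1 s2 p1 p2; rewrite leqNgt; apply/negP => lt12.
  (* the endpoint of the smaller piece would lie in the larger one *)
  have /and3P[/negP ne _ _] := s2; apply: ne.
  apply: (piece_sub s1 (endpoint_lt _)); move: p1 p2 => /andP[n1 c1] /andP[n2 c2].
  have /eqP e := same_cell_le lt12 c2; have /eqP e' := same_cell_le (leqW lt12) c2.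
  by rewrite /piece /block /same_cell -e -e' -!/(same_cell _ _ _) n1.
move=> s s' p p'; have ii : q.2 = q'.2.
  by apply/val_inj/eqP; rewrite eqn_leq (lt _ _ s s')// (lt _ _ s' s).
have a0 : forall q, piece_sel q -> q.1 = false -> 0 < a.
  by move=> [t i] /and3P[+ _ _] /= te; rewrite te /=; lia.
case: q q' s s' p p' ii => [t i] [t' i'] s s' p p' /= ii; subst i'.
case: (eqVneq t t') => [->//|tt'].
case: t t' s s' p p' tt' => -[] //= s s' /andP[p1 p2] /andP[p3 p4] _.
- by case: (@ends_differ i n nab (a0 _ s' erefl)).
- by case: (@ends_differ i n nab (a0 _ s erefl)).
Qed.

Let sel_of (q : bool * 'I_N) n : a <= n < b -> piece q n ->
  ~~ (a <= endpoint q.1 < b) ->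
  ~~ same_cell q.2 n b -> (0 < a -> ~~ same_cell q.2 n a.-1) -> piece_sel q.
Proof.
move=> /andP[an nb] pq eI cb ca; apply/and3P; split => //; last first.
  have nN : n < 2 ^ N by lia.
  by apply/existsP; exists (Ordinal nN).
apply/forallP => n'; apply/implyP => pq'.
have cc : same_cell q.2 n' n.
  move: pq pq' => /andP[h1 h2] /andP[h3 h4]; move: h1 h2 h3 h4.
  rewrite /same_cell !cellS; set x := n %/ _; set y := nat_of_ord n' %/ _; set z := _ %/ _.
  lia.
have [n'a|n'a] := leqP a n'; last first.
  have := ca (leq_ltn_trans (leq0n _) n'a); rewrite /same_cell => /negP[].
  have /eqP-> : same_cell q.2 a.-1 n' by apply: (@same_cell_mid q.2 n' a.-1 n) => //; lia.
  by rewrite eq_sym.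
have [//|n'b] := ltnP n' b.
case/negP: cb; rewrite /same_cell eq_sym.
by apply: (@same_cell_mid q.2 n b n' (ltnW nb)) => //; rewrite /same_cell eq_sym.
Qed.

(** The piece with the lower of the two levels at which n separates from the
endpoints: no endpoint lies in its cell, and intervals are convex. *)
Lemma piece_exists n : a <= n < b -> exists q, piece_sel q && piece q n.
Proof.
move=> nab; have nN : n < 2 ^ N by lia.
have [i1 h1] : exists i : 'I_N, block b i n by apply: block_exists => //; lia.
have [a0|a0] := posnP a.
  exists (true, i1); apply/andP; split => //; apply: (sel_of nab) => //=; rewrite ?a0//; last by case/andP: h1.
  by rewrite ltnn andbF.
have [i0 h0] : exists i : 'I_N, block a.-1 i n by apply: block_exists => //; lia.
have [ii|ii] := leqP i0 i1.
  exists (false, i0); apply/andP; split => //; apply: (sel_of nab) => //=; first by lia.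
    by case/andP: h1 => h1 _; apply: contra h1; exact: same_cell_le.
  by case/andP: h0.
exists (true, i1); apply/andP; split => //; apply: (sel_of nab) => //=; first by rewrite ltnn andbF.
  by case/andP: h1.
by case/andP: h0 => h0 _ _; apply: contra h0; apply: same_cell_le; exact: ltnW.
Qed.

End DyadicBlocks.


(** * The inequality on a finite group *)
Section WalshGroup.
Variables (R : realType) (N : nat).

Definition bits := {ffun 'I_N -> bool}.

Definition flip (k : nat) (x : bits) : bits :=
  [ffun i : 'I_N => x i (+) (val i == k)].

Definition flip2 (j : bool * nat) (x : bits * bits) : bits * bits :=
  if j.1 then (x.1, flip j.2 x.2) else (flip j.2 x.1, x.2).

Definition character (n : nat) (x : bits) : R :=
  \prod_(i < N) (-1) ^+ (bit n i && x i).

Definition character2 (n : nat * nat) (x : bits * bits) : R :=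
  character n.1 x.1 * character n.2 x.2.

(** Flipping the digit of highest index is the finest operation: the digit k
governs the frequencies 2^k, ..., 2^(k+1) - 1. *)
Definition fine_to_coarse (v : bool) (d : nat) : bool * nat := (v, (N - d.+1)%N).

Lemma flipK k : involutive (flip k).
Proof. by move=> x; apply/ffunP => i; rewrite !ffunE -addbA addbb addbF. Qed.

Lemma flipC k k' x : flip k (flip k' x) = flip k' (flip k x).
Proof. by apply/ffunP => i; rewrite !ffunE addbAC. Qed.

Lemma flip2K j : involutive (flip2 j).
Proof. by case: j => -[] k [x y]; rewrite /flip2 /= flipK. Qed.

Lemma flip2C j j' x : flip2 j (flip2 j' x) = flip2 j' (flip2 j x).
Proof.
by case: j j' x => -[] k [[] k'] [x y]; rewrite /flip2//= flipC.
Qed.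

Lemma character_flip n (k : 'I_N) x :
  character n (flip k x) = (-1) ^+ (bit n k) * character n x.
Proof.
rewrite /character (bigD1 k)//= [in RHS](bigD1 k)//= mulrA; congr (_ * _).
  by rewrite ffunE eqxx addbT; case: bit; case: (x k) => /=; rewrite ?expr1 ?expr0; ring.
by apply: eq_bigr => i ik; rewrite ffunE val_eqE (negbTE ik) addbF.
Qed.

Lemma character_sqr n x : character n x ^+ 2 = 1.
Proof. by rewrite -prodrXl big1// => i _; rewrite sqrr_sign. Qed.

Lemma character2_sqr n x : character2 n x ^+ 2 = 1.
Proof. by rewrite exprMn !character_sqr mulr1. Qed.

Definition pick2 (A : Type) (v : bool) (p : A * A) := if v then p.2 else p.1.

Lemma character2_flip n v (k : 'I_N) x :
  character2 n (flip2 (v, val k) x) = (-1) ^+ bit (pick2 v n) k * character2 n x.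
Proof.
case: v; rewrite /character2 /flip2 /= character_flip; last by rewrite mulrA.
by rewrite mulrCA.
Qed.

Lemma mem_prefix v d j : (d <= N)%N ->
  (j \in prefix (fine_to_coarse v) d) = (j.1 == v) && (N - d <= j.2 < N)%N.
Proof.
case: j => w k; elim: d => [_|d IH dN] /=.
  by rewrite in_nil subn0; case: leqP; rewrite ?andbF// andbC andFb.
rewrite inE IH ?(ltnW dN)// /fine_to_coarse xpair_eqE /=; case: eqP => //= _.
lia.
Qed.

End WalshGroup.

Section Modulation.
Variables (R : realType) (I : eqType) (T : finType) (th : I -> T -> T).
Hypothesis thK : forall i, involutive (th i).
Hypothesis thC : forall i j x, th i (th j x) = th j (th i x).

(** A coordinate sign [rho] changes the conditional expectation one level up into
the martingale difference at this level. *)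
Lemma avg_modulated (c : nat -> I) d (rho h : T -> R) x :
  flip_inv th (prefix c d) rho -> (forall y, rho (th (c d) y) = - rho y) ->
  avg th (prefix c d.+1) (fun y => rho y * h y) x = rho x * avg_diff th c d h x.
Proof.
move=> ri ra; rewrite [avg _ _ _ _]/= /flip_avg !avgMl// ra /avg_diff.
by field.
Qed.

Lemma avg_anti (l : seq I) i (f : T -> R) x :
  i \in l -> (forall y, f (th i y) = - f y) -> avg th l f x = 0.
Proof.
move=> il fi; have := flip_inv_avg thK thC f il x.
rewrite avg_flip// (eq_avg th l (g := fun y => -1 * f y)); last first.
  by move=> y /=; rewrite fi mulN1r.
rewrite avgZ; lra.
Qed.

Lemma sum_anti i (f : T -> R) : (forall y, f (th i y) = - f y) -> \sum_x f x = 0.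
Proof.
move=> fi; have := sum_flip thK i f; under eq_bigr do rewrite fi.
rewrite sumrN; lra.
Qed.

End Modulation.

Section WalshRectangles.
Variables (R : realType) (N : nat) (K : finType) (a1 b1 a2 b2 : K -> nat).
Hypotheses (ab1 : forall k, (a1 k <= b1 k)%N) (ab2 : forall k, (a2 k <= b2 k)%N).
Hypotheses (bN1 : forall k, (b1 k < 2 ^ N)%N) (bN2 : forall k, (b2 k < 2 ^ N)%N).
Hypothesis disj : forall k k' m n,
  (a1 k <= m < b1 k)%N -> (a2 k <= n < b2 k)%N ->
  (a1 k' <= m < b1 k')%N -> (a2 k' <= n < b2 k')%N -> k = k'.

Local Notation X := (bits N * bits N)%type.
Local Notation th := (@flip2 N).
Local Notation c v := (fine_to_coarse N v).
(* A tile: a rectangle, one of its four corners, and the depths in the second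
   and in the first variable, nested as they come out of the iteration of the
   square function. *)
Implicit Types s t : ((K * (bool * bool)) * 'I_N) * 'I_N.

Definition tile_rect s : K := s.1.1.1.
Let sides s : bool * bool := s.1.1.2.
Definition tile_depth1 s : 'I_N := s.2.
Definition tile_depth2 s : 'I_N := s.1.2.
Let piece1 s : bool * 'I_N := ((sides s).1, rev_ord (tile_depth1 s)).
Let piece2 s : bool * 'I_N := ((sides s).2, rev_ord (tile_depth2 s)).
Let in1 s n := piece (a1 (tile_rect s)) (b1 (tile_rect s)) (piece1 s) n.
Let in2 s n := piece (a2 (tile_rect s)) (b2 (tile_rect s)) (piece2 s) n.

Definition tile_sel s := piece_sel (a1 (tile_rect s)) (b1 (tile_rect s)) (piece1 s) &&
  piece_sel (a2 (tile_rect s)) (b2 (tile_rect s)) (piece2 s).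

Definition corner (q : K * (bool * bool)) :=
  (endpoint (a1 q.1) (b1 q.1) q.2.1, endpoint (a2 q.1) (b2 q.1) q.2.2).

Let coord v (k : 'I_N) (x : X) : R := (-1) ^+ (pick2 v x) k.

Definition tile_char s (x : X) : R := character2 R (corner s.1.1) x *
  (coord false (piece1 s).2 x * coord true (piece2 s).2 x).

Definition tile_flips s :=
  prefix (c false) (tile_depth1 s).+1 ++ prefix (c true) (tile_depth2 s).+1.

Local Notation P := (tile_proj th tile_flips tile_char).

Let coord_flip v k w (m : 'I_N) x :
  coord v k (th (w, val m) x) = (-1) ^+ ((v == w) && (m == k)) * coord v k x.
Proof.
rewrite /coord /flip2; case: v; case: w => //=; rewrite ?expr0 ?mul1r// ffunE.
  by rewrite addbC signr_addb val_eqE eq_sym.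
by rewrite addbC signr_addb val_eqE eq_sym.
Qed.

Let tile_sign s v (m : 'I_N) : bool :=
  bit (pick2 v (corner s.1.1)) m (+) (m == pick2 v ((piece1 s).2, (piece2 s).2)).

Let tile_char_flip s v (m : 'I_N) x :
  tile_char s (th (v, val m) x) = (-1) ^+ tile_sign s v m * tile_char s x.
Proof.
rewrite /tile_char character2_flip !coord_flip /tile_sign signr_addb.
by case: v => /=; rewrite expr0 mul1r; ring.
Qed.

Lemma tile_char_sqr s x : tile_char s x ^+ 2 = 1.
Proof. by rewrite /tile_char exprMn character2_sqr exprMn /coord !sqrr_sign !mulr1. Qed.

Let mem_flips s v (m : 'I_N) :
  ((v, val m) \in tile_flips s) = (pick2 v ((piece1 s).2, (piece2 s).2) <= m)%N.
Proof.
have h (d : 'I_N) w : ((v, val m) \in prefix (c w) (nat_of_ord d).+1) =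
    (v == w) && (rev_ord d <= m)%N.
  rewrite mem_prefix ?(ltn_ord d)//=; case: (v == w) => //=.
  by have := ltn_ord m; lia.
by rewrite /tile_flips mem_cat !h; case: (v) => //=; rewrite orbF.
Qed.

Let flips_ord s v k : (v, k) \in tile_flips s -> exists m : 'I_N, k = val m.
Proof.
rewrite mem_cat => /orP[]; rewrite mem_prefix ?(ltn_ord _)//= => /and3P[_ _ kN].
  by exists (Ordinal kN).
by exists (Ordinal kN).
Qed.

Let tile_proj_flip s g j x : j \in tile_flips s ->
  forall v (m : 'I_N), j = (v, val m) -> P s g (th j x) = (-1) ^+ tile_sign s v m * P s g x.
Proof.
move=> jl v m je; rewrite /tile_proj (flip_inv_avg (@flip2K N) (@flip2C N) _ jl).
by rewrite je tile_char_flip -mulrA.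
Qed.

Let pieceE s v n : (n < 2 ^ N)%N ->
  (if v then in2 s n else in1 s n) =
  [forall m : 'I_N, ((v, val m) \in tile_flips s) ==> (bit n m == tile_sign s v m)].
Proof.
move=> nN; have e1 := endpoint_lt (ab1 (tile_rect s)) (bN1 (tile_rect s)) (sides s).1.
have e2 := endpoint_lt (ab2 (tile_rect s)) (bN2 (tile_rect s)) (sides s).2.
by case: v; rewrite /in1 /in2 /piece (block_bits _ nN)//; apply: eq_forallb => m; rewrite mem_flips.
Qed.

(** Two tile projections have orthogonal ranges as soon as some common flip
changes the sign of one and not of the other.  If no flip does this, then in
each variable the shorter frequency piece is contained in the longer one, so the
two tiles share a frequency; disjointness of the rectangles and uniqueness of
the pieces make the tiles equal. *)
Lemma tile_orth s t : tile_sel s -> tile_sel t -> s != t ->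
  forall g, \sum_x P s g x * P t g x = 0.
Proof.
move=> ss tt st g.
have [/existsP[v /existsP[m /and3P[ms mt neq]]]|] :=
  boolP [exists v : bool, exists m : 'I_N, [&& (v, val m) \in tile_flips s,
    (v, val m) \in tile_flips t & tile_sign s v m != tile_sign t v m]].
  apply: (sum_anti (@flip2K N) (i := (v, val m))) => x.
  rewrite (tile_proj_flip g x ms erefl) (tile_proj_flip g x mt erefl).
  move: neq; case: (tile_sign s v m); case: (tile_sign t v m) => //= _;
  rewrite ?expr0 ?expr1; ring.
rewrite negb_exists => /forallP agree; exfalso.
(* otherwise the two frequency rectangles share a point *)
have common v : exists2 n, (n < 2 ^ N)%N &
    (if v then in2 s n else in1 s n) && (if v then in2 t n else in1 t n).
  have {agree} agree (m : 'I_N) : (v, val m) \in tile_flips s -> (v, val m) \in tile_flips t ->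
      tile_sign s v m = tile_sign t v m.
    move=> h1 h2; move: (agree v); rewrite negb_exists => /forallP/(_ m).
    by rewrite h1 h2 /= negbK => /eqP.
  have ex r : tile_sel r -> exists2 n, (n < 2 ^ N)%N & (if v then in2 r n else in1 r n).
    move=> /andP[/and3P[_ _ /existsP[n1 h1]] /and3P[_ _ /existsP[n2 h2]]].
    by case: v {agree}; [exists n2|exists n1].
  have [[n nN hn] [n' nN' hn']] := (ex _ ss, ex _ tt).
  have sub r r' : (forall m : 'I_N, (v, val m) \in tile_flips r ->
        (v, val m) \in tile_flips r' -> tile_sign r v m = tile_sign r' v m) ->
      (forall m : 'I_N, (v, val m) \in tile_flips r' -> (v, val m) \in tile_flips r) ->
      forall n, (n < 2 ^ N)%N ->
      (if v then in2 r n else in1 r n) -> (if v then in2 r' n else in1 r' n).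
    move=> ag fl k kN; rewrite !pieceE// => /forallP h; apply/forallP => m; apply/implyP => mr'.
    by have := h m; rewrite (fl _ mr') /= => /eqP->; rewrite ag// fl.
  have [le|le] := leqP (pick2 v ((piece1 s).2, (piece2 s).2))
    (pick2 v ((piece1 t).2, (piece2 t).2)).
    exists n => //; rewrite hn; apply: (sub s t) => // m.
    by rewrite !mem_flips; exact: leq_trans.
  exists n' => //; rewrite hn' andbT; apply: (sub t s) => // m.
    by move=> h1 h2; rewrite agree.
  by rewrite !mem_flips; apply: leq_trans; exact: ltnW.
have [n1 n1N /= /andP[s1 t1]] := common false.
have [n2 n2N /= /andP[s2 t2]] := common true.
have /andP[ss1 ss2] := ss; have /andP[tt1 tt2] := tt.
have i1 := piece_sub ss1 n1N s1; have i2 := piece_sub ss2 n2N s2.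
have j1 := piece_sub tt1 n1N t1; have j2 := piece_sub tt2 n2N t2.
have kk : tile_rect s = tile_rect t := disj i1 i2 j1 j2.
move: (tt1) (tt2) (t1) (t2); rewrite /in1 /in2 -kk => tt1' tt2' t1' t2'.
have q1 := piece_unique (ab1 _) (bN1 _) i1 ss1 tt1' s1 t1'.
have q2 := piece_unique (ab2 _) (bN2 _) i2 ss2 tt2' s2 t2'.
case/eqP: st; move: kk q1 q2; rewrite /tile_rect /piece1 /piece2 /sides /tile_depth1 /tile_depth2.
case: (s) (t) => -[[k [u v]] d] d' [[[k' [u' v']] e] e'] /= -> [-> h1] [-> h2].
by congr (_, _, _); apply/rev_ord_inj/val_inj.
Qed.

Let tile_proj_character s n x : (n.1 < 2 ^ N)%N -> (n.2 < 2 ^ N)%N ->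
  P s (character2 R n) x = (in1 s n.1 && in2 s n.2)%:R * character2 R n x.
Proof.
move=> n1N n2N; pose u (x : X) := tile_char s x * character2 R n x.
have uf v (m : 'I_N) y : u (th (v, val m) y) =
    (-1) ^+ (tile_sign s v m (+) bit (pick2 v n) m) * u y.
  by rewrite /u tile_char_flip character2_flip signr_addb; ring.
have pE v : (if v then in2 s n.2 else in1 s n.1) =
  [forall m : 'I_N, ((v, val m) \in tile_flips s) ==> (bit (pick2 v n) m == tile_sign s v m)].
  by have := pieceE s v (_ : (pick2 v n < 2 ^ N)%N); case: v => ->.
have [/andP[i1 i2]|] := boolP (in1 s n.1 && in2 s n.2).
  rewrite mul1r /tile_proj avg_id; last first.
    move=> [v k] jl y; have [m km] := flips_ord jl; rewrite km in jl *.
    rewrite -/(u _) uf; have : (if v then in2 s n.2 else in1 s n.1) by case: v {jl km}.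
    by rewrite pE => /forallP/(_ m); rewrite jl /= => /eqP->; rewrite addbb expr0 mul1r.
  by rewrite mulrA -expr2 tile_char_sqr mul1r.
rewrite mul0r negb_and => h.
have [v] : exists v, ~~ (if v then in2 s n.2 else in1 s n.1).
  by case/orP: h; [exists false|exists true].
rewrite pE negb_forall => /existsP[m]; rewrite negb_imply => /andP[ml neq].
rewrite /tile_proj (avg_anti (@flip2K N) (@flip2C N) _ ml) ?mulr0// => y.
rewrite -/(u _) uf; move: neq; case: bit; case: tile_sign => //= _; rewrite ?expr1 mulN1r//.
Qed.

(** The projection on a tile is a double martingale difference, conjugated by the
character of a corner.  This is what the square function controls. *)
Lemma tile_proj_avg_diff s g x : P s g x = character2 R (corner s.1.1) x *
  avg_diff th (c false) (tile_depth1 s)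
    (avg_diff th (c true) (tile_depth2 s) (fun y => character2 R (corner s.1.1) y * g y)) x.
Proof.
set h := fun y => character2 R (corner s.1.1) y * g y.
have inv v (d : 'I_N) w (d' : nat) : (d' <= N)%N -> (v == w) ==> (d' <= d)%N ->
    flip_inv th (prefix (c w) d') (coord v (rev_ord d)).
  move=> d'N vw [w' k]; rewrite mem_prefix//= => /and3P[/eqP-> h1 h2] y.
  rewrite (coord_flip v _ w (Ordinal h2)) -val_eqE/=.
  case: eqP vw => [_|_]; rewrite ?expr0 ?mul1r//= => dd.
  rewrite gtn_eqF ?expr0 ?mul1r//; have := ltn_ord d; lia.
have anti v (d : 'I_N) y : coord v (rev_ord d) (th (c v d) y) = - coord v (rev_ord d) y.
  by rewrite (coord_flip v _ v (rev_ord d)) !eqxx expr1 mulN1r.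
rewrite /tile_proj /tile_char -!mulrA; congr (_ * _).
set r1 := coord false (piece1 s).2; set r2 := coord true (piece2 s).2.
rewrite (eq_avg th (tile_flips s) (g := fun y => r1 y * (r2 y * h y))); last first.
  by move=> y; rewrite /h; ring.
rewrite avg_cat.
rewrite (eq_avg th _
  (g := fun y => r2 y * (r1 y * avg_diff th (c true) (tile_depth2 s) h y))); last first.
  move=> y; rewrite avgMl; last by apply: inv; rewrite ?(ltn_ord _).
  rewrite avg_modulated//; last 2 first.
  - by apply: inv; rewrite ?(ltnW (ltn_ord _))// leqnn.
  - exact: anti.
  by rewrite mulrCA.
rewrite avgMl; last by apply: inv; rewrite ?(ltn_ord _).
rewrite avg_modulated//; last 2 first.
- by apply: inv; rewrite ?(ltnW (ltn_ord _))// leqnn.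
- exact: anti.
set z := avg_diff _ _ _ _ _.
have -> : r1 x * (r2 x * (r2 x * (r1 x * z))) = r1 x ^+ 2 * r2 x ^+ 2 * z by ring.
by rewrite /r1 /r2 /coord !sqrr_sign !mul1r.
Qed.

Variables (A : K -> seq (nat * nat)) (cf : K -> nat * nat -> R).
Hypothesis spec : forall k n, n \in A k -> (a1 k <= n.1 < b1 k)%N && (a2 k <= n.2 < b2 k)%N.

Definition walsh_poly k (x : X) : R := \sum_(n <- A k) cf k n * character2 R n x.

Let tile_proj_poly s k x :
  P s (walsh_poly k) x = \sum_(n <- A k) cf k n * P s (character2 R n) x.
Proof.
rewrite /tile_proj /walsh_poly.
rewrite (eq_avg th _
  (g := fun y => \sum_(n <- A k) cf k n * (tile_char s y * character2 R n y))); last first.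
  by move=> y; rewrite mulr_sumr; apply: eq_bigr => n _; rewrite mulrCA.
rewrite avg_sum mulr_sumr; apply: eq_bigr => n _.
by rewrite avgZ mulrCA.
Qed.

Let tile_reproduce k x :
  \sum_(s | tile_sel s && (tile_rect s == k)) P s (walsh_poly (tile_rect s)) x = walsh_poly k x.
Proof.
rewrite (eq_bigr (fun s => \sum_(n <- A k) cf k n * P s (character2 R n) x)); last first.
  by move=> s /andP[_ /eqP->]; rewrite tile_proj_poly.
rewrite exchange_big/= big_seq [RHS]big_seq; apply: eq_bigr => n nA.
rewrite -mulr_sumr; congr (_ * _).
have /andP[n1 n2] := spec nA.
have n1N : (n.1 < 2 ^ N)%N by have := bN1 k; lia.
have n2N : (n.2 < 2 ^ N)%N by have := bN2 k; lia.
under eq_bigr do rewrite tile_proj_character//.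
rewrite -mulr_suml -[RHS]mul1r; congr (_ * _).
have [q1 /andP[sq1 p1]] := piece_exists (ab1 k) (bN1 k) n1.
have [q2 /andP[sq2 p2]] := piece_exists (ab2 k) (bN2 k) n2.
(* depths count from the finest digit, levels from the digit 0 *)
pose s0 := (((k, (q1.1, q2.1)), rev_ord q2.2), rev_ord q1.2).
have e1 : piece1 s0 = q1 by rewrite /piece1 /sides /tile_depth1 /= rev_ordK; case: (q1).
have e2 : piece2 s0 = q2 by rewrite /piece2 /sides /tile_depth2 /= rev_ordK; case: (q2).
rewrite (bigD1 s0)/=; last by rewrite /tile_sel e1 e2 sq1 sq2 /tile_rect /= eqxx.
rewrite [X in (in1 s0 _ && _)%:R + X]big1.
  by rewrite /in1 /in2 e1 e2 p1 p2 addr0.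
move=> s /andP[/andP[/andP[s1 s2] /eqP sk] ss0].
case: (boolP (_ && _)) => // /andP[h1 h2]; exfalso; case/eqP: ss0.
rewrite /in1 /in2 !sk in s1 s2 h1 h2.
have := piece_unique (ab1 k) (bN1 k) n1 sq1 s1 p1 h1.
have := piece_unique (ab2 k) (bN2 k) n2 sq2 s2 p2 h2.
move: sk; rewrite /s0 /piece1 /piece2 /sides /tile_depth1 /tile_depth2 /tile_rect.
by case: (s) => -[[k' [u v]] d] d' /= -> -> ->; rewrite /= !rev_ordK.
Qed.

(** Every frequency of the k-th rectangle belongs to exactly one of its
tiles. *)
Lemma tile_decomposition x :
  \sum_(s | tile_sel s) P s (walsh_poly (tile_rect s)) x = \sum_k walsh_poly k x.
Proof.
rewrite (partition_big tile_rect predT)//=; apply: eq_bigr => k _.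
exact: tile_reproduce.
Qed.

End WalshRectangles.

(** The factor 2 in front of [B] accounts for the four corners of a rectangle:
the modulated functions together have a square function at most 2 B. *)
Lemma walsh_rectangles_bound (R : realType) (p : R) : 1 < p -> p <= 2 ->
  exists2 C : R, 0 < C &
  forall (N : nat) (K : finType) (a1 b1 a2 b2 : K -> nat),
    (forall k, a1 k <= b1 k)%N -> (forall k, a2 k <= b2 k)%N ->
    (forall k, b1 k < 2 ^ N)%N -> (forall k, b2 k < 2 ^ N)%N ->
    (forall k k' m n,
      (a1 k <= m < b1 k)%N -> (a2 k <= n < b2 k)%N ->
      (a1 k' <= m < b1 k')%N -> (a2 k' <= n < b2 k')%N -> k = k') ->
  forall (A : K -> seq (nat * nat)) (cf : K -> nat * nat -> R),
    (forall k n, n \in A k -> (a1 k <= n.1 < b1 k)%N && (a2 k <= n.2 < b2 k)%N) ->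
  forall B : bits N * bits N -> R, (forall x, 0 < B x) ->
    (forall x : bits N * bits N, \sum_k walsh_poly A cf k x ^+ 2 <= B x ^+ 2) ->
  \sum_(x : bits N * bits N) `|\sum_k walsh_poly A cf k x| `^ p <= C * \sum_x B x `^ p.
Proof.
move=> p1 p2; have [C1 C10 square] := square_function_bound p1 p2.
have [C2 C20 synth] := tile_synthesis_bound p1 p2.
exists (C2 * (C1 * (C1 * 2 `^ p))) => [|N K a1 b1 a2 b2 ab1 ab2 bN1 bN2 disj A cf spec B B0 FB].
  by rewrite !mulr_gt0// powR_gt0.
have thK := @flip2K N; have thC := @flip2C N.
pose F1 (q : K * (bool * bool)) (x : bits N * bits N) :=
  character2 R (corner a1 b1 a2 b2 q) x * walsh_poly A cf q.1 x.
have B20 x : 0 < 2 * B x by rewrite mulr_gt0.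
have FB1 x : \sum_q F1 q x ^+ 2 <= (2 * B x) ^+ 2.
  rewrite -(pair_bigA _ (fun k t => F1 (k, t) x ^+ 2))/=.
  rewrite (eq_bigr (fun k => 4 * walsh_poly A cf k x ^+ 2)) => [|k _]; last first.
    rewrite (eq_bigr (fun=> walsh_poly A cf k x ^+ 2)) => [|t _]; last first.
      by rewrite /F1 exprMn character2_sqr mul1r.
    by rewrite sumr_const card_prod card_bool mulr_natl.
  by rewrite -mulr_sumr exprMn; have := FB x; lra.
have [B1 [B10 FB2 B1p]] := square _ _ _ thK thC (fine_to_coarse N true) _ _ _ N B20 FB1.
have [B2 [B20' FB3 B2p]] := square _ _ _ thK thC (fine_to_coarse N false) _ _ _ N B10 FB2.
under eq_bigr do rewrite -(tile_decomposition ab1 ab2 bN1 bN2 cf spec).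
apply: (@le_trans _ _ (C2 * \sum_x B2 x `^ p)).
  apply: (synth _ _ _ thK thC (fine_to_coarse N false) (fine_to_coarse N true) N _
    (tile_sel a1 b1 a2 b2) (fun s => (tile_depth1 s).+1) (fun s => (tile_depth2 s).+1)
    (tile_char R a1 b1 a2 b2)) => //.
  - by move=> s; rewrite !ltn_ord.
  - exact: tile_char_sqr.
  - exact: tile_orth.
  - by move=> s _ x; apply: tile_proj_idem => //; exact: tile_char_sqr.
  - move=> x; apply: le_trans (FB3 x).
    rewrite big_mkcond/=; apply: ler_sum => s _; case: ifP => _; last exact: sqr_ge0.
    rewrite tile_proj_avg_diff exprMn character2_sqr mul1r.
    by rewrite /F1 /tile_depth1 /tile_depth2 /tile_rect.
rewrite -!mulrA ler_wpM2l ?(ltW C20)//.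
apply: le_trans B2p _; rewrite ler_wpM2l ?(ltW C10)//.
apply: le_trans B1p _; rewrite ler_wpM2l ?(ltW C10)// mulr_sumr ler_sum// => x _.
by rewrite powRM// ltW.
Qed.


(** * Dyadic cells of the unit square *)
Section DyadicCells.
Variable R : realType.
Local Notation leb := (@lebesgue_measure R).

Lemma sgn_sin_shift (q : nat) (s : R) : 0 < s -> s < 1 ->
  Num.sg (sin ((q%:R + s) * pi)) = (-1) ^+ odd q.
Proof.
move=> s0 s1; elim: q => [|q IH].
  rewrite add0r /= expr0; apply: gtr0_sg; apply: sin_gt0_pi.
  by rewrite mulr_gt0 ?pi_gt0//= -[ltRHS]mul1r ltr_pM2r ?pi_gt0.
have -> : (q.+1%:R + s) * pi = (q%:R + s) * pi + pi :> R by rewrite -natr1; ring.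
by rewrite sinDpi sgrN IH /=; case: odd => /=; rewrite ?expr0 ?expr1 ?opprK.
Qed.

(** The dyadic cell number [m] corresponds to the binary digits of [m], the
highest one first. *)
Definition digits N (m : nat) : bits N := [ffun k : 'I_N => odd (m %/ 2 ^ (N - k.+1))].

Lemma rademacher_digits N (m : nat) (k : 'I_N) (x : R) :
  m%:R / 2 ^+ N < x -> x < m.+1%:R / 2 ^+ N ->
  rademacher k.+1 x = (-1) ^+ (digits N m k).
Proof.
move=> mx xm; rewrite /rademacher ffunE.
set e := (N - k.+1)%N; set q := (m %/ 2 ^ e)%N.
have eN : (e + k.+1)%N = N by rewrite /e subnK.
pose s := 2 ^+ k.+1 * x - q%:R.
have p2 n : 0 < 2 ^+ n :> R by rewrite exprn_gt0.
have e2 : 2 ^+ N = 2 ^+ e * 2 ^+ k.+1 :> R by rewrite -exprD eN.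
have lo : q%:R < 2 ^+ k.+1 * x.
  rewrite -ltr_pdivrMl// mulrC; apply: le_lt_trans mx.
  rewrite ler_pdivlMr// mulrAC ler_pdivrMr// e2 mulrA ler_pM2r//.
  by rewrite -natrX -natrM ler_nat leq_trunc_div.
have hi : 2 ^+ k.+1 * x < q%:R + 1.
  rewrite -ltr_pdivlMl// mulrC; apply: lt_le_trans xm _.
  rewrite ler_pdivrMr// mulrAC ler_pdivlMr// e2 mulrA ler_pM2r//.
  rewrite natr1 -natrX -natrM ler_nat.
  rewrite mulnC -ltnS; have := ltn_ceil m (_ : (0 < 2 ^ e)%N).
  by rewrite expn_gt0 /= => /(_ isT); rewrite -/q; lia.
have -> : 2 ^+ k.+1 * pi * x = (q%:R + s) * pi by rewrite /s; ring.
by apply: sgn_sin_shift; rewrite /s; lra.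
Qed.

Lemma digits_inj N : injective (fun m : 'I_(2 ^ N) => digits N m).
Proof.
move=> m m' /ffunP e; apply/val_inj/eqP.
have : same_cell 0 m m'.
  apply: (same_cell_bits (N := N)) => // k /andP[_ kN].
  have kN' : (N - k.+1 < N)%N by lia.
  have := e (Ordinal kN'); rewrite !ffunE /bit /=.
  by have -> : (N - (N - k.+1).+1 = k)%N by lia.
by rewrite /same_cell !divn1.
Qed.

Lemma digits_surj N (b : bits N) : exists m : 'I_(2 ^ N), digits N m = b.
Proof.
have : bijective (fun m : 'I_(2 ^ N) => digits N m).
  by apply: inj_card_bij; [exact: digits_inj|rewrite card_ffun card_bool !card_ord].
by case=> g _ gK; exists (g b); rewrite gK.
Qed.

Definition cell N (b : bits N) : set (measurableTypeR R) :=
  `[0, 1] `&` [set x | forall k : 'I_N, rademacher k.+1 x = (-1) ^+ (b k)].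

Lemma measurable_rademacher k : measurable_fun setT (fun x : measurableTypeR R => rademacher k x).
Proof.
have mh : measurable_fun setT (fun x : measurableTypeR R => sin (2 ^+ k * pi * x)).
  apply: measurableT_comp; last by apply: measurable_funM.
  exact: continuous_measurable_fun (@continuous_sin R).
rewrite [X in measurable_fun _ X](_ : _ = fun x =>
    if sin (2 ^+ k * pi * x) < 0 then -1 else if 0 < sin (2 ^+ k * pi * x) then 1 else 0).
  apply: measurable_fun_ifT => //; first exact: measurable_fun_ltr.
  by apply: measurable_fun_ifT => //; exact: measurable_fun_ltr.
apply/funext => x; rewrite /rademacher.
by case: sgrP; rewrite ?ltxx.
Qed.

Lemma measurable_cell N (b : bits N) : measurable (cell b).
Proof.
apply: measurableI; first exact: measurable_itv.
rewrite [X in measurable X](_ : _ = \bigcap_(k in [set: 'I_N])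
    ((fun x : measurableTypeR R => rademacher k.+1 x) @^-1` [set (-1) ^+ (b k)])).
  apply: fin_bigcap_measurable => // k _; rewrite -[X in measurable X]setTI.
  by apply: measurable_rademacher => //; exact: measurable_set1.
by apply/seteqP; split => x /= h k; [move=> _; exact: h|exact: h].
Qed.

Lemma cell_disjoint N (b b' : bits N) x : cell b x -> cell b' x -> b = b'.
Proof.
move=> [_ h] [_ h']; apply/ffunP => k; apply: (@signr_inj R).
by rewrite /= -h -h'.
Qed.

Lemma cell_measure_ge N (b : bits N) : ((2 ^+ N)^-1%:E <= leb (cell b))%E.
Proof.
have [m <-] := digits_surj b.
have p2 : 0 < 2 ^+ N :> R by rewrite exprn_gt0.
pose J : set R := `](m%:R / 2 ^+ N), (m.+1%:R / 2 ^+ N)[%classic.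
have -> : (2 ^+ N)^-1%:E = leb J.
  rewrite /J lebesgue_measure_itv /= lte_fin ltr_pM2r ?invr_gt0// ltr_nat ltnSn.
  by rewrite -EFinD -mulrBl -(natr1 m) addrAC subrr add0r mul1r.
apply: le_measure; rewrite ?inE; [exact: measurable_itv|exact: measurable_cell|].
move=> x; rewrite /J /= in_itv/= => /andP[mx xm]; split.
  rewrite /= in_itv/= (ltW (le_lt_trans _ mx)) ?divr_ge0 ?(ltW p2)//=.
  rewrite (ltW (lt_le_trans xm _))// ler_pdivrMr// mul1r -natrX ler_nat.
  exact: ltn_ord.
by move=> k; exact: rademacher_digits.
Qed.

(** Every cell contains an open dyadic interval of length 2^-N, and the 2^N
disjoint cells have total measure at most 1. *)
Lemma cell_measure N (b : bits N) : leb (cell b) = (2 ^+ N)^-1%:E.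
Proof.
have p2 : 0 < 2 ^+ N :> R by rewrite exprn_gt0.
pose U := \big[setU/set0]_(b <- index_enum (bits N)) cell b.
have UE : leb U = (\sum_(b : bits N) leb (cell b))%E.
  have mU : measurable U by apply: bigsetU_measurable => b' _; exact: measurable_cell.
  rewrite -[LHS]mul1e -integral_cst// ge0_integral_bigsetU//.
  - by apply: eq_bigr => b' _; rewrite integral_cst ?mul1e//; exact: measurable_cell.
  - by move=> b'; exact: measurable_cell.
  - exact: index_enum_uniq.
  - by move=> b1 b2 _ _ [x [/cell_disjoint h /h]].
have U1 : (leb U <= 1)%E.
  have -> : 1%E = leb (`[0, 1]%classic : set R).
    by rewrite lebesgue_measure_itv /= lte_fin ltr01 -EFinD subr0.
  apply: le_measure; rewrite ?inE.
  - by apply: bigsetU_measurable => b' _; exact: measurable_cell.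
  - exact: measurable_itv.
  - by rewrite /U -bigcup_seq => x [b' _ []].
have fin (b' : bits N) : leb (cell b') \is a fin_num.
  rewrite ge0_fin_numE//; apply: le_lt_trans (ltry 1); apply: le_trans U1.
  apply: le_measure; rewrite ?inE; first exact: measurable_cell.
    by apply: bigsetU_measurable => b'' _; exact: measurable_cell.
  by rewrite /U -bigcup_seq => x cx; exists b' => //=; rewrite mem_index_enum.
pose r (b' : bits N) := fine (leb (cell b')).
have rE b' : leb (cell b') = (r b')%:E by rewrite fineK.
have r_ge b' : 0 <= r b' - (2 ^+ N)^-1.
  by rewrite subr_ge0 -lee_fin -rE cell_measure_ge.
have : \sum_b' (r b' - (2 ^+ N)^-1) = 0.
  apply/eqP; rewrite eq_le sumr_ge0 ?andbT//.
  rewrite sumrB sumr_const card_ffun card_bool card_ord.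
  rewrite -[X in _ - X]mulr_natl natrX mulfV ?gt_eqF//.
  by rewrite subr_le0 -lee_fin -sumEFin; under eq_bigr do rewrite -rE; rewrite -UE.
move=> /eqP; rewrite psumr_eq0// => /allP/(_ b (mem_index_enum _))/= /eqP h.
by rewrite rE; congr EFin; lra.
Qed.

End DyadicCells.

Arguments cell R {N} b.

Section SquareCells.
Variables (R : realType) (N : nat).
Local Notation T := (measurableTypeR R * measurableTypeR R)%type.
Local Notation mu := (lebesgue_square R).

Definition cell2 (b : bits N * bits N) : set T := cell R b.1 `*` cell R b.2.

Lemma measurable_cell2 b : measurable (cell2 b).
Proof. by apply: measurableX; exact: measurable_cell. Qed.

Lemma cell2_disjoint b b' x : cell2 b x -> cell2 b' x -> b = b'.
Proof.
case: b b' => [b1 b2] [b1' b2'] [/= h1 h2] [/= h1' h2'].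
by rewrite (cell_disjoint h1 h1') (cell_disjoint h2 h2').
Qed.

Lemma lebesgue_squareT : mu setT = 1%E.
Proof.
have I1 : @lebesgue_measure R (`[0, 1]%classic : set R) = 1%E.
  by rewrite lebesgue_measure_itv /= lte_fin ltr01 -EFinD subr0.
rewrite /lebesgue_square /= /mrestr setTI product_measure1E; [|exact: measurable_itv|exact: measurable_itv].
by rewrite [X in (X * _)%E]I1 [X in (_ * X)%E]I1 mule1.
Qed.

Lemma cell2_measure b : mu (cell2 b) = (4 ^+ N)^-1%:E.
Proof.
rewrite /lebesgue_square /= /mrestr setIidl; last first.
  by move=> [x y] [[h _] [h' _]]; split.
rewrite product_measure1E; [|exact: measurable_cell|exact: measurable_cell].
rewrite [X in (X * _)%E]cell_measure [X in (_ * X)%E]cell_measure.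
by rewrite -EFinM -invfM -exprMn -natrM.
Qed.

Lemma integral_cells (G : T -> \bar R) (Phi : bits N * bits N -> R) :
  measurable_fun setT G -> (forall x, 0 <= G x)%E ->
  (forall b x, cell2 b x -> G x = (Phi b)%:E) ->
  (\int[mu]_x G x = ((4 ^+ N)^-1 * \sum_b Phi b)%:E)%E.
Proof.
move=> mG G0 GPhi.
have p4 : 0 < 4 ^+ N :> R by rewrite exprn_gt0.
pose D := \big[setU/set0]_(b <- index_enum (bits N * bits N)%type) cell2 b.
have mD : measurable D by apply: bigsetU_measurable => b' _; exact: measurable_cell2.
have tD : trivIset [set` index_enum (bits N * bits N)%type] cell2.
  by move=> b1 b2 _ _ [x [/cell2_disjoint h /h]].
have split_int (g : T -> \bar R) (psi : bits N * bits N -> R) :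
    measurable_fun setT g -> (forall x, 0 <= g x)%E ->
    (forall b x, cell2 b x -> g x = (psi b)%:E) ->
    (\int[mu]_(x in D) g x = ((4 ^+ N)^-1 * \sum_b psi b)%:E)%E.
  move=> mg g0 gpsi; rewrite ge0_integral_bigsetU//; last 3 first.
  - exact: measurable_cell2.
  - exact: index_enum_uniq.
  - exact: measurable_funTS.
  rewrite mulr_sumr -sumEFin; apply: eq_bigr => b _.
  rewrite (eq_integral (fun=> (psi b)%:E)); last by move=> x; rewrite inE => /gpsi.
  by rewrite integral_cst ?cell2_measure -?EFinM 1?mulrC//; exact: measurable_cell2.
have muD : mu D = 1%E.
  rewrite -[LHS]mul1e -integral_cst// (split_int _ (fun=> 1))//.
  rewrite sumr_const card_prod card_ffun card_bool card_ord -natrX -expnMn natrX.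
  by rewrite mulVf// gt_eqF.
have muDC : mu (~` D) = 0%E.
  have := measureU mu mD (measurableC mD) (setICr D).
  rewrite setUCr => /(etrans (esym lebesgue_squareT)) h.
  have {h} : (1 = 1 + mu (~` D))%E by rewrite [LHS]h -[X in (_ = X + _)%E]muD.
  by case: (mu _) => [r| |] //= -[h]; congr EFin; lra.
rewrite -(setUCr D) ge0_integral_setU//; last 3 first.
- exact: measurableC.
- by rewrite setUCr.
- by rewrite disj_set2E setICr.
rewrite (split_int _ Phi)// [X in (_ + X)%E](_ : _ = 0%E) ?adde0//.
apply: null_set_integral => //; first exact: measurableC.
exact: measurable_funTS.
Qed.

End SquareCells.

Arguments cell2 R {N} b.


(** * Walsh polynomials on the unit square *)
Section ComplexFunctions.
Variable R : realType.
Local Notation T := (measurableTypeR R * measurableTypeR R)%type.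
Local Notation normc := (@Normc.normc R).
Implicit Types (f g : T -> R[i]).

Lemma normcE_sqr (z : R[i]) : normc z ^+ 2 = complex.Re z ^+ 2 + complex.Im z ^+ 2.
Proof. by case: z => a b /=; rewrite sqr_sqrtr// addr_ge0 ?sqr_ge0. Qed.

Lemma normc_ge0 (z : R[i]) : 0 <= normc z.
Proof. by case: z => a b /=; rewrite sqrtr_ge0. Qed.

Lemma normc_triangle (z w : R[i]) : normc (z + w) <= normc z + normc w.
Proof. exact: le_normcD. Qed.

Lemma normc_sum (I : Type) (r : seq I) (P : pred I) (F : I -> R[i]) :
  normc (\sum_(i <- r | P i) F i) <= \sum_(i <- r | P i) normc (F i).
Proof.
elim/big_rec2: _ => [|i x y _ IH]; first by rewrite /= expr0n /= addr0 sqrtr0.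
by apply: le_trans (normc_triangle _ _) _; rewrite lerD2l.
Qed.

Lemma normc_le_ReIm (z : R[i]) : normc z <= `|complex.Re z| + `|complex.Im z|.
Proof.
rewrite -ler_sqr ?nnegrE ?normc_ge0 ?addr_ge0// normcE_sqr.
rewrite sqrrD !real_normK ?num_real//.
have : 0 <= `|complex.Re z| * `|complex.Im z| by rewrite mulr_ge0.
lra.
Qed.

Lemma Re_sum (I : Type) (r : seq I) (P : pred I) (F : I -> R[i]) :
  complex.Re (\sum_(i <- r | P i) F i) = \sum_(i <- r | P i) complex.Re (F i).
Proof. by elim/big_rec2: _ => // i x [a b] _ /= <-; case: (F i). Qed.

Lemma Im_sum (I : Type) (r : seq I) (P : pred I) (F : I -> R[i]) :
  complex.Im (\sum_(i <- r | P i) F i) = \sum_(i <- r | P i) complex.Im (F i).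
Proof. by elim/big_rec2: _ => // i x [a b] _ /= <-; case: (F i). Qed.

Definition cmeasurable f :=
  measurable_fun setT (fun x => complex.Re (f x)) /\
  measurable_fun setT (fun x => complex.Im (f x)).

Lemma cmeasurable_sum (I : Type) (r : seq I) (P : pred I) (F : I -> T -> R[i]) :
  (forall i, cmeasurable (F i)) -> cmeasurable (fun x => \sum_(i <- r | P i) F i x).
Proof.
move=> mF; split.
  under eq_fun do rewrite Re_sum big_mkcond.
  apply: measurable_sum => i; case: (P i) => //; exact: (mF i).1.
under eq_fun do rewrite Im_sum big_mkcond.
by apply: measurable_sum => i; case: (P i) => //; exact: (mF i).2.
Qed.

Lemma cmeasurableB f g : cmeasurable f -> cmeasurable g -> cmeasurable (fun x => f x - g x).
Proof.
move=> [mf mf'] [mg mg']; split.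
  rewrite [X in measurable_fun _ X](_ : _ = fun x => complex.Re (f x) - complex.Re (g x)).
    exact: measurable_funB.
  by apply/funext => x; case: (f x); case: (g x).
rewrite [X in measurable_fun _ X](_ : _ = fun x => complex.Im (f x) - complex.Im (g x)).
  exact: measurable_funB.
by apply/funext => x; case: (f x); case: (g x).
Qed.

Lemma measurable_normc_sqr f : cmeasurable f ->
  measurable_fun setT (fun x => normc (f x) ^+ 2).
Proof.
move=> [mf mf']; under eq_fun do rewrite normcE_sqr.
by apply: measurable_funD; apply: measurable_funX.
Qed.

Lemma measurable_normc f : cmeasurable f -> measurable_fun setT (fun x => normc (f x)).
Proof.
move=> mf; rewrite [X in measurable_fun _ X](_ : _ = fun x => (normc (f x) ^+ 2) `^ 2^-1).
  apply: (measurableT_comp (f := fun y : R => y `^ 2^-1)); first exact: measurable_powR.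
  exact: measurable_normc_sqr.
apply/funext => x; rewrite powR12_sqrt ?sqr_ge0// sqrtr_sqr.
by rewrite ger0_norm ?normc_ge0.
Qed.

End ComplexFunctions.

Lemma powR_add_le (R : realType) (a b p : R) : 0 <= p -> 0 <= a -> 0 <= b ->
  (a + b) `^ p <= 2 `^ p * (a `^ p + b `^ p).
Proof.
move=> p0 a0 b0.
have m0 : 0 <= Num.max a b by rewrite le_max a0.
have abm : a + b <= 2 * Num.max a b.
  by rewrite mulr_natl mulr2n lerD// le_max lexx ?orbT.
apply: (@le_trans _ _ ((2 * Num.max a b) `^ p)).
  by apply: ge0_ler_powR; rewrite ?nnegrE ?addr_ge0 ?mulr_ge0.
rewrite powRM// ler_wpM2l ?powR_ge0//.
by case: (leP a b) => _; rewrite ?lerDl ?lerDr powR_ge0.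
Qed.

Section WalshOnCells.
Variables (R : realType) (N : nat).
Local Notation T := (measurableTypeR R * measurableTypeR R)%type.

Lemma walsh_cell n (b : bits N) x : (n < 2 ^ N)%N -> cell R b x ->
  walsh n x = character R n b.
Proof.
move=> nN [_ bx]; rewrite /walsh /character.
have off k : (n <= k)%N -> odd (n %/ 2 ^ k) = false.
  by move=> nk; rewrite divn_small// (leq_ltn_trans nk)// ltn_expl.
have offN k : (N <= k)%N -> odd (n %/ 2 ^ k) = false.
  by move=> nk; rewrite divn_small// (leq_trans nN)// leq_exp2l.
rewrite big_mkcond/= (eq_bigr (fun i : 'I_N =>
    if odd (n %/ 2 ^ i) then rademacher i.+1 x else 1)); last first.
  by move=> i _; rewrite /bit bx; case: odd => //=; rewrite expr0.
pose F k := if odd (n %/ 2 ^ k) then rademacher k.+1 x else 1.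
rewrite -/(F _) -(big_mkord predT F).
have all m m' : (forall k, (m <= k)%N -> odd (n %/ 2 ^ k) = false) -> (m <= m')%N ->
    \prod_(0 <= k < m) F k = \prod_(0 <= k < m') F k.
  move=> h mm; rewrite [RHS](big_cat_nat (n := m))//= [X in _ * X]big_nat_cond.
  by rewrite [X in _ * X]big1 ?mulr1// => k /andP[/andP[mk _] _]; rewrite /F h.
by rewrite (all n (maxn n N) off (leq_maxl _ _)) (all N (maxn n N) offN (leq_maxr _ _)).
Qed.

Lemma measurable_walsh n : measurable_fun setT (fun x : measurableTypeR R => walsh n x).
Proof.
rewrite /walsh; under eq_fun do rewrite big_mkcond.
elim: (index_iota 0 n) => [|k s IH].
  by under eq_fun do rewrite big_nil; exact: measurable_cst.
under eq_fun do rewrite big_cons; apply: measurable_funM => //.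
by case: odd; [exact: measurable_rademacher | exact: measurable_cst].
Qed.

Lemma cmeasurable_walsh_term (c : R[i]) n : cmeasurable (fun x : T => c * walsh2 n x).
Proof.
have mw : measurable_fun setT (fun x : T => walsh n.1 x.1 * walsh n.2 x.2).
  apply: measurable_funM.
    exact: (measurableT_comp (@measurable_walsh _) measurable_fst).
  exact: (measurableT_comp (@measurable_walsh _) measurable_snd).
case: c => a b; split.
  rewrite [X in measurable_fun _ X](_ : _ = fun x : T => a * (walsh n.1 x.1 * walsh n.2 x.2)).
    exact: measurable_funM.
  by apply/funext => x; rewrite /walsh2/= mulr0 subr0.
rewrite [X in measurable_fun _ X](_ : _ = fun x : T => b * (walsh n.1 x.1 * walsh n.2 x.2)).
  exact: measurable_funM.
by apply/funext => x; rewrite /walsh2/= mulr0 add0r.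
Qed.

End WalshOnCells.

Lemma interval_trace (I : set nat) M :
  (forall a b c, I a -> I c -> (a <= b <= c)%N -> I b) ->
  exists a b, [/\ (a <= b)%N, (b <= M)%N & forall n, (n < M)%N -> I n <-> (a <= n < b)%N].
Proof.
move=> cvx; elim: M => [|M [a [b [ab bM h]]]]; first by exists 0%N, 0%N; split.
have [IM|nIM] := pselect (I M); last first.
  exists a, b; split => //; first exact: leqW.
  move=> n nM1; have [->|ne] := eqVneq n M; last by apply: h; lia.
  by split => // /andP[_]; rewrite ltnNge bM.
have [ab'|ba] := ltnP a b; last first.
  exists M, M.+1; split => // n nM1; have [->|ne] := eqVneq n M.
    by split => // _; lia.
  by rewrite h; lia.
have bM' : b = M.
  apply/eqP; rewrite eqn_leq bM leqNgt; apply/negP => bM'.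
  have Ia : I a by apply/h; [exact: leq_trans bM|rewrite leqnn].
  by have /(h _ bM') := cvx _ _ _ Ia IM (introT andP (conj ab bM)); rewrite ltnn andbF.
exists a, M.+1; split => //; first by lia.
move=> n nM1; have [->|ne] := eqVneq n M; first by split=> // _; lia.
by rewrite h; lia.
Qed.

Section WalshPolynomials.
Variables (R : realType) (K : finType).
Local Notation T := (measurableTypeR R * measurableTypeR R)%type.
Local Notation mu := (lebesgue_square R).
Local Notation normc := (@Normc.normc R).
Variables (A : K -> seq (nat * nat)) (c : K -> nat * nat -> R[i]).

Definition walsh_sum k (x : T) : R[i] := \sum_(n <- A k) c k n * walsh2 n x.

Lemma cmeasurable_walsh_sum k : cmeasurable (walsh_sum k).
Proof. by apply: cmeasurable_sum => n; exact: cmeasurable_walsh_term. Qed.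

Lemma walsh_sum_cell N k (b : bits N * bits N) x :
  (forall n, n \in A k -> (n.1 < 2 ^ N)%N && (n.2 < 2 ^ N)%N) -> cell2 R b x ->
  walsh_sum k x = Complex (walsh_poly A (fun k n => complex.Re (c k n)) k b)
                          (walsh_poly A (fun k n => complex.Im (c k n)) k b).
Proof.
move=> AN [b1 b2]; apply/eqP; rewrite eq_complex /= /walsh_sum /walsh_poly Re_sum Im_sum.
apply/andP; split; apply/eqP; rewrite big_seq [RHS]big_seq; apply: eq_bigr => n nA;
  have /andP[n1 n2] := AN n nA; rewrite /character2 -(walsh_cell n1 b1) -(walsh_cell n2 b2) /walsh2.
  by case: (c k n) => u v /=; rewrite mulr0 subr0.
by case: (c k n) => u v /=; rewrite mulr0 add0r.
Qed.

End WalshPolynomials.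

(** The constant [d] makes the right-hand side positive, as the finite inequality
requires.  Real and imaginary parts are treated separately; their square
functions are at most that of the complex family. *)
Lemma walsh_sum_bound (R : realType) (p : R) : 1 < p -> p <= 2 ->
  exists2 C : R, 0 < C &
  forall (K : finType) (I1 I2 : K -> set nat) (A : K -> seq (nat * nat))
    (c : K -> nat * nat -> R[i]),
  disjoint_rectangles I1 I2 ->
  (forall k n, n \in A k -> I1 k n.1 /\ I2 k n.2) ->
  forall d : R, 0 < d ->
  (\int[lebesgue_square R]_x (Normc.normc (\sum_k walsh_sum A c k x) `^ p)%:E <=
   C%:E * \int[lebesgue_square R]_x
     ((\sum_k Normc.normc (walsh_sum A c k x) ^+ 2 + d) `^ (p / 2))%:E)%E.
Proof.
move=> p1 p2; have [C C0 bound] := walsh_rectangles_bound p1 p2.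
(* 2^p from splitting |u + i v|^p, one C for each of u and v *)
exists (2 `^ p * (C + C)) => [|K I1 I2 A c [int1 int2 disj] spec d d0].
  by rewrite mulr_gt0 ?powR_gt0 ?addr_gt0.
have p0 : 0 <= p by lra.
pose M := (\max_k \max_(n <- A k) (maxn n.1 n.2).+1)%N.
have AM k n : n \in A k -> (n.1 < M)%N && (n.2 < M)%N.
  move=> nA; have : ((maxn n.1 n.2).+1 <= M)%N.
    apply: leq_trans (leq_bigmax (F := fun k => \max_(n <- A k) (maxn n.1 n.2).+1)%N k).
    exact: (leq_bigmax_seq (F := fun n => (maxn n.1 n.2).+1)).
  by rewrite gtn_max.
have trace (I : K -> set nat) : (forall k, nat_interval (I k)) ->
    exists ab : K -> nat * nat, forall k, [/\ ((ab k).1 <= (ab k).2)%N, ((ab k).2 <= M)%N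
      & forall n, (n < M)%N -> I k n <-> ((ab k).1 <= n < (ab k).2)%N].
  move=> iI.
  have ex k : exists ab : nat * nat, [/\ (ab.1 <= ab.2)%N, (ab.2 <= M)%N
      & forall n, (n < M)%N -> I k n <-> (ab.1 <= n < ab.2)%N].
    by have [a [b h]] := interval_trace M (iI k).2; exists (a, b).
  by have [f hf] := choice ex; exists f.
have [ab1 h1] := trace _ int1; have [ab2 h2] := trace _ int2.
have MN : (M < 2 ^ M)%N by exact: ltn_expl.
have AN k n : n \in A k -> (n.1 < 2 ^ M)%N && (n.2 < 2 ^ M)%N.
  by move=> /AM /andP[n1 n2]; rewrite !(leq_trans _ (ltnW MN)).
pose re := walsh_poly (N := M) A (fun k n => complex.Re (c k n)).
pose im := walsh_poly (N := M) A (fun k n => complex.Im (c k n)).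
pose Q b := \sum_k (re k b ^+ 2 + im k b ^+ 2) + d.
have Q0 b : 0 < Q b.
  by rewrite ltr_wpDl// sumr_ge0// => k _; rewrite addr_ge0 ?sqr_ge0.
pose B b := Num.sqrt (Q b).
have B0 b : 0 < B b by rewrite sqrtr_gt0.
have Bsq b : B b ^+ 2 = Q b by rewrite sqr_sqrtr// ltW.
have Bp b : B b `^ p = Q b `^ (p / 2).
  by rewrite /B -powR12_sqrt ?(ltW (Q0 _))// -powRrM mulrC.
have disc cf : (forall b, \sum_k walsh_poly (N := M) A cf k b ^+ 2 <= B b ^+ 2) ->
    \sum_b `|\sum_k walsh_poly (N := M) A cf k b| `^ p <= C * \sum_b B b `^ p.
  move=> cfB; apply: (bound M K (fun k => (ab1 k).1) (fun k => (ab1 k).2)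
      (fun k => (ab2 k).1) (fun k => (ab2 k).2)) => //.
  - by move=> k; have [] := h1 k.
  - by move=> k; have [] := h2 k.
  - by move=> k; have [_ + _] := h1 k; lia.
  - by move=> k; have [_ + _] := h2 k; lia.
  - move=> k k' m n km kn k'm k'n.
    have mM : (m < M)%N by have [_ + _] := h1 k; lia.
    have nM : (n < M)%N by have [_ + _] := h2 k; lia.
    apply: (disj k k' Logic.I Logic.I); exists (m, n); split; split => /=.
    + by have [_ _ h] := h1 k; apply/h.
    + by have [_ _ h] := h2 k; apply/h.
    + by have [_ _ h] := h1 k'; apply/h.
    + by have [_ _ h] := h2 k'; apply/h.
  - move=> k n nA; have /andP[n1 n2] := AM _ _ nA; have [i1 i2] := spec _ _ nA.
    by apply/andP; split; [have [_ _ h] := h1 k; apply/h | have [_ _ h] := h2 k; apply/h].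
have dre : \sum_b `|\sum_k re k b| `^ p <= C * \sum_b B b `^ p.
  apply: disc => b; rewrite Bsq /Q -[leLHS]addr0 lerD ?(ltW d0)//.
  by apply: ler_sum => k _; rewrite lerDl sqr_ge0.
have dim : \sum_b `|\sum_k im k b| `^ p <= C * \sum_b B b `^ p.
  apply: disc => b; rewrite Bsq /Q -[leLHS]addr0 lerD ?(ltW d0)//.
  by apply: ler_sum => k _; rewrite lerDr sqr_ge0.
have mS k := @cmeasurable_walsh_sum R K A c k.
have gE k b x : cell2 R b x -> walsh_sum A c k x = Complex (re k b) (im k b).
  by move=> bx; apply: walsh_sum_cell bx => n; exact: AN.
rewrite (integral_cells (Phi := fun b =>
    Normc.normc (Complex (\sum_k re k b) (\sum_k im k b)) `^ p)); last 3 first.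
- apply/measurable_EFinP; apply: (measurableT_comp (f := fun y : R => y `^ p)).
    exact: measurable_powR.
  by apply: measurable_normc; exact: cmeasurable_sum.
- by move=> x; rewrite lee_fin powR_ge0.
- move=> b x bx; congr (EFin (Normc.normc _ `^ p)).
  apply/eqP; rewrite eq_complex Re_sum Im_sum /=; apply/andP.
  by split; apply/eqP/eq_bigr => k _; rewrite (gE _ _ _ bx).
rewrite (integral_cells (Phi := fun b => Q b `^ (p / 2))); last 3 first.
- apply/measurable_EFinP; apply: (measurableT_comp (f := fun y : R => y `^ (p / 2))).
    exact: measurable_powR.
  apply: measurable_funD => //; apply: measurable_sum => k.
  exact: measurable_normc_sqr.
- by move=> x; rewrite lee_fin powR_ge0.
- move=> b x bx; congr (EFin ((_ + _) `^ _)); apply: eq_bigr => k _.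
  by rewrite normcE_sqr (gE _ _ _ bx).
rewrite -EFinM lee_fin mulrCA ler_wpM2l ?invr_ge0 ?exprn_ge0//.
apply: (@le_trans _ _ (2 `^ p * (\sum_b `|\sum_k re k b| `^ p + \sum_b `|\sum_k im k b| `^ p))).
  rewrite -big_split mulr_sumr; apply: ler_sum => b _ /=.
  apply: le_trans (powR_add_le p0 (normr_ge0 _) (normr_ge0 _)).
  apply: ge0_ler_powR => //; rewrite ?nnegrE ?addr_ge0 ?normc_ge0//.
  exact: (normc_le_ReIm (Complex _ _)).
rewrite -mulrA ler_wpM2l ?powR_ge0// mulrDl.
by under [X in C * X]eq_bigr do rewrite -Bp; rewrite lerD.
Qed.


(** * Finite families *)
Section Integrals.
Variable R : realType.
Local Notation T := (measurableTypeR R * measurableTypeR R)%type.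
Local Notation mu := (lebesgue_square R).
Local Notation normc := (@Normc.normc R).
Implicit Types (u v w : T -> R) (f : T -> R[i]) (p : R).

Lemma cnorm_poweR p f : p != 0 ->
  (cnorm p f `^ p = \int[mu]_x (normc (f x) `^ p)%:E)%E.
Proof.
move=> p0; rewrite /cnorm poweR_Lnorm//; apply: eq_integral => x _ /=.
by rewrite ger0_norm ?normc_ge0// poweR_EFin.
Qed.

Lemma integral_le_lin u v w (a b : R) :
  measurable_fun setT u -> measurable_fun setT v -> measurable_fun setT w ->
  (forall x, 0 <= u x) -> (forall x, 0 <= v x) -> (forall x, 0 <= w x) ->
  0 <= a -> 0 <= b -> (forall x, u x <= a * v x + b * w x) ->
  (\int[mu]_x (u x)%:E <= a%:E * \int[mu]_x (v x)%:E + b%:E * \int[mu]_x (w x)%:E)%E.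
Proof.
move=> mu_ mv mw u0 v0 w0 a0 b0 uvw.
have mE (g : T -> R) : measurable_fun setT g -> measurable_fun setT (EFin \o g).
  by move=> mg; exact/measurable_EFinP.
rewrite -!ge0_integralZl_EFin//; try (by move=> x _; rewrite lee_fin); try exact: mE.
rewrite -ge0_integralD//; first last.
- by under eq_fun do rewrite -EFinM; apply: mE; apply: measurable_funM.
- by move=> x _; rewrite -EFinM lee_fin mulr_ge0.
- by under eq_fun do rewrite -EFinM; apply: mE; apply: measurable_funM.
- by move=> x _; rewrite -EFinM lee_fin mulr_ge0.
apply: ge0_le_integral => //.
- by move=> x _; rewrite lee_fin.
- exact: mE.
- under eq_fun do rewrite -!EFinM -EFinD.
  by apply: mE; apply: measurable_funD; apply: measurable_funM.
- by move=> x _; rewrite -!EFinM -EFinD lee_fin.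
Qed.

Lemma measurable_powR_comp u p : measurable_fun setT u ->
  measurable_fun setT (fun x => u x `^ p).
Proof.
by move=> mu_; apply: (measurableT_comp (f := fun y : R => y `^ p)) => //; exact: measurable_powR.
Qed.

(** The spectral condition is convergence along finite sets of frequencies, so it
supplies Walsh polynomials with frequencies in [I] close to [f] in L^2. *)
Lemma spectral_approximation (I : set (nat * nat)) f : cmeasurable f ->
  walsh_spectrum_in I f -> forall e : R, 0 < e ->
  exists (A : seq (nat * nat)) (c : nat * nat -> R[i]), (forall n, n \in A -> I n) /\
    (\int[mu]_x (normc (\sum_(n <- A) c n * walsh2 n x - f x) ^+ 2)%:E <= e%:E)%E.
Proof.
move=> mf [_ cv] e e0; pose d := e `^ 2^-1.
have d0 : 0 < d by exact: powR_gt0.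
have [A _ /(_ A (fsubset_refl A)) /= hA] := cv _ (nbhs_open_ereal_lt (f := fun=> d) d0).
exists [seq n <- A | n \in I], (fun n => cdot f (walsh2 n)); split.
  by move=> n; rewrite mem_filter => /andP[/set_mem].
have -> : (\int[mu]_x (normc (\sum_(n <- [seq n <- A | n \in I])
      cdot f (walsh2 n) * walsh2 n x - f x) ^+ 2)%:E =
    cnorm 2 (fun x => \sum_(n <- A | n \in I) cdot f (walsh2 n) * walsh2 n x - f x)%R `^ 2)%E.
  rewrite cnorm_poweR//; apply: eq_integral => x _.
  by rewrite big_filter powR_mulrn ?normc_ge0.
have -> : e = d `^ 2 by rewrite /d -powRrM mulVf// powRr1// ltW.
rewrite -poweR_EFin; apply: gt0_ler_poweR => //; last exact: ltW.
- by rewrite in_itv/= leey andbT Lnorm_ge0.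
- by rewrite in_itv/= leey andbT lee_fin ltW.
Qed.

End Integrals.

(** Serves to make the integral of y^s small when that of y is, since the measure
is a probability. *)
Lemma powR_le_affine (R : realType) (s eta y : R) : 0 <= s -> s <= 1 -> 0 < eta -> 0 <= y ->
  y `^ s <= eta `^ s + eta `^ (s - 1) * y.
Proof.
move=> s0 s1 e0 y0; have [ye|ey] := leP y eta.
  rewrite -[leLHS]addr0 lerD ?mulr_ge0 ?powR_ge0//.
  by apply: ge0_ler_powR; rewrite ?nnegrE// ltW.
have y1 : 0 < y by exact: lt_trans ey.
have [sE|sn] := eqVneq s 0; first by rewrite sE !powRr0 lerDl mulr_ge0 ?powR_ge0.
have -> : y `^ s = y `^ (s - 1) * y.
  by rewrite mulrC mulr_powRB1// lt_neqAle eq_sym sn.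
rewrite -[leLHS]add0r lerD ?powR_ge0// ler_wpM2r//.
by apply: powR_le_npos => //; [exact: ltW | rewrite subr_le0].
Qed.

Lemma sqr_sum_le (R : realType) (K : finType) (a : K -> R) :
  (\sum_k a k) ^+ 2 <= #|K|%:R * \sum_k a k ^+ 2.
Proof.
have cross j k : a j * a k <= (a j ^+ 2 + a k ^+ 2) / 2.
  by have := sqr_ge0 (a j - a k); nra.
rewrite expr2 mulr_suml.
apply: (@le_trans _ _ (\sum_j \sum_k (a j ^+ 2 + a k ^+ 2) / 2)).
  by apply: ler_sum => j _; rewrite mulr_sumr ler_sum.
under eq_bigr do rewrite -mulr_suml big_split/= sumr_const.
rewrite -mulr_suml big_split/= sumr_const sumrMnl -mulr_natl; lra.
Qed.

Local Notation normc := (@Normc.normc _).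

(** Approximate the f_k by Walsh polynomials g_k.  Both sides change by at most a
multiple of the integral of w = (L (D + d))^(p/2), where D = sum |g_k - f_k|^2;
by [powR_le_affine] it is arbitrarily small with the L^2 distances. *)
Lemma finite_family_bound (R : realType) (p : R) : 1 < p -> p <= 2 ->
  exists2 C : R, 0 < C &
  forall (K : finType) (I1 I2 : K -> set nat)
    (f : K -> measurableTypeR R * measurableTypeR R -> R[i]),
  disjoint_rectangles I1 I2 -> walsh_family I1 I2 f ->
  (\int[lebesgue_square R]_x (Normc.normc (\sum_k f k x) `^ p)%:E <=
   C%:E * \int[lebesgue_square R]_x
     ((\sum_k Normc.normc (f k x) ^+ 2) `^ (p / 2))%:E)%E.
Proof.
move=> p1 p2; have [C C0 bound] := walsh_sum_bound p1 p2.
have p0 : 0 <= p by lra.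
pose s := p / 2.
have s0 : 0 <= s by rewrite /s; lra.
have s1 : s <= 1 by rewrite /s; lra.
pose c2 := 2 `^ p; pose cs := 2 `^ s.
have c20 : 0 < c2 by exact: powR_gt0.
have cs0 : 0 < cs by exact: powR_gt0.
exists (c2 * (C * (cs * cs))) => [|K I1 I2 f disj fam]; first by rewrite !mulr_gt0.
have mf k : cmeasurable (f k) by have [[]] := fam k.
apply/lee_addgt0Pr => e e0.
(* L absorbs the factors 2 and #|K| of the two pointwise bounds below *)
pose L : R := 2 + #|K|%:R; have L0 : 0 < L by rewrite ltr_wpDr.
pose C3 := c2 * (C * cs + 1); have C30 : 0 < C3 by rewrite mulr_gt0// addr_gt0// mulr_gt0.
pose eta := (e / (2 * C3)) `^ s^-1.
have sp : 0 < s by rewrite /s; lra.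
have e2 : 0 < e / (2 * C3) by rewrite divr_gt0// mulr_gt0.
have eta0 : 0 < eta by exact: powR_gt0.
have etas : eta `^ s = e / (2 * C3).
  by rewrite /eta -powRrM mulVf ?gt_eqF// powRr1// ltW.
pose slope := eta `^ (s - 1) * L; have sl0 : 0 < slope by rewrite mulr_gt0// powR_gt0.
have [d d0 dE] : exists2 d : R, 0 < d & slope * (L * d) = e / (2 * C3).
  exists (e / (2 * C3) / slope / L); first by do 2 apply: divr_gt0 => //.
  by field; rewrite !gt_eqF.
have ap k := spectral_approximation (mf k) (fam k).2 d0.
have [A /choice[c Ac]] := choice ap.
pose g := walsh_sum A c.
pose D x := \sum_k normc (g k x - f k x) ^+ 2.
pose w x := (L * (D x + d)) `^ s.
pose G x := \sum_k normc (g k x) ^+ 2.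
pose F x := \sum_k normc (f k x) ^+ 2.
have D0 x : 0 <= D x by rewrite sumr_ge0// => k _; rewrite sqr_ge0.
have F0 x : 0 <= F x by rewrite sumr_ge0// => k _; rewrite sqr_ge0.
have mg k : cmeasurable (g k) by exact: cmeasurable_walsh_sum.
have mD : measurable_fun setT D.
  by apply: measurable_sum => k; apply: measurable_normc_sqr; exact: cmeasurableB.
have mF : measurable_fun setT F.
  by apply: measurable_sum => k; exact: measurable_normc_sqr.
have mG : measurable_fun setT G.
  by apply: measurable_sum => k; exact: measurable_normc_sqr.
have mw : measurable_fun setT w.
  by apply: measurable_powR_comp; apply: measurable_funM => //; exact: measurable_funD.
have step1 x : normc (\sum_k f k x) `^ p <= c2 * normc (\sum_k g k x) `^ p + c2 * w x.
  rewrite -mulrDr.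
  apply: (@le_trans _ _ ((normc (\sum_k g k x) + normc (\sum_k (g k x - f k x))) `^ p)).
    apply: ge0_ler_powR; rewrite ?nnegrE ?addr_ge0 ?normc_ge0//.
    have -> : \sum_k f k x = \sum_k g k x + - \sum_k (g k x - f k x).
      by rewrite sumrB opprB addrC subrK.
    by apply: le_trans (normc_triangle _ _) _; rewrite normcN.
  apply: le_trans (powR_add_le p0 (normc_ge0 _) (normc_ge0 _)) _.
  rewrite ler_wpM2l ?(ltW c20)// lerD2l.
  set z := \sum_k (g k x - f k x).
  have -> : normc z `^ p = (normc z ^+ 2) `^ s.
    by rewrite -powR_mulrn ?normc_ge0// -powRrM /s mulrC divfK.
  apply: ge0_ler_powR; rewrite ?nnegrE ?sqr_ge0 ?mulr_ge0 ?addr_ge0 ?(ltW d0) ?(ltW L0)//.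
  apply: (@le_trans _ _ ((\sum_k normc (g k x - f k x)) ^+ 2)).
    by rewrite ler_sqr ?nnegrE ?normc_ge0 ?sumr_ge0// ?normc_sum// => k _; exact: normc_ge0.
  apply: le_trans (sqr_sum_le _) _; rewrite -/(D x) /L.
  have : 0 <= #|K|%:R :> R by []. 
  have := D0 x; have := d0; nra.
have step2 x : (G x + d) `^ s <= cs * cs * F x `^ s + cs * w x.
  apply: (@le_trans _ _ ((2 * F x + L * (D x + d)) `^ s)).
    apply: ge0_ler_powR; rewrite ?nnegrE ?addr_ge0 ?mulr_ge0 ?addr_ge0 ?(ltW d0) ?(ltW L0)//.
      by rewrite sumr_ge0// => k _; rewrite sqr_ge0.
    have GFD : G x <= 2 * F x + 2 * D x.
      rewrite /G /F /D !mulr_sumr -big_split ler_sum// => k _ /=.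
      have := normc_triangle (f k x) (g k x - f k x); rewrite (addrC (f k x)) subrK.
      have := normc_ge0 (g k x); have := normc_ge0 (f k x); have := normc_ge0 (g k x - f k x).
      set a := normc _; set b := normc _; set t := normc _; move=> a0 b0 t0 tab.
      have := sqr_ge0 (a - b); nra.
    have : 0 <= #|K|%:R :> R by [].
    rewrite /L; have := D0 x; have := d0; nra.
  have F20 : 0 <= 2 * F x by rewrite mulr_ge0.
  have LD0 : 0 <= L * (D x + d) by rewrite mulr_ge0 ?addr_ge0 ?(ltW d0) ?(ltW L0).
  apply: le_trans (powR_add_le s0 F20 LD0) _.
  have -> : (2 * F x) `^ s = cs * F x `^ s by rewrite powRM.
  by rewrite le_eqVlt; apply/orP; left; apply/eqP; rewrite /w /cs; ring.
have intD : (\int[lebesgue_square R]_x (D x)%:E <= (#|K|%:R * d)%:E)%E.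
  under eq_integral do rewrite /D -sumEFin.
  rewrite ge0_integral_sum//.
  - have -> : (#|K|%:R * d)%:E = (\sum_(k : K) d%:E)%E.
      by rewrite sumEFin sumr_const mulr_natl.
    by apply: lee_sum => k _; exact: (Ac k).2.
  - by move=> k; apply/measurable_EFinP; apply: measurable_normc_sqr; exact: cmeasurableB.
  - by move=> k x _; rewrite lee_fin sqr_ge0.
have cst_int (a : R) : (\int[lebesgue_square R]_x a%:E = a%:E)%E.
  by rewrite integral_cst// lebesgue_squareT mule1.
have wint : (\int[lebesgue_square R]_x (w x)%:E <= (e / C3)%:E)%E.
  have wle x : w x <= (e / (2 * C3) + slope * d) * 1 + slope * D x.
    apply: le_trans (powR_le_affine s0 s1 eta0 _) _; last by rewrite etas /slope; lra.
    by rewrite mulr_ge0 ?addr_ge0 ?(ltW d0) ?(ltW L0).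
  have sd0 : 0 <= slope * d by rewrite mulr_ge0 ?ltW.
  apply: le_trans (integral_le_lin mw _ mD _ _ D0 _ _ wle) _ => //.
  - by move=> x; exact: powR_ge0.
  - by rewrite addr_ge0// ltW.
  - exact: ltW.
  rewrite cst_int mule1.
  apply: (@le_trans _ _ ((e / (2 * C3) + slope * d)%:E + slope%:E * (#|K|%:R * d)%:E)%E).
    by rewrite leeD2l// lee_pmul2l.
  rewrite -EFinM -EFinD lee_fin.
  have -> : e / C3 = e / (2 * C3) + slope * (L * d).
    by rewrite dE; field; rewrite gt_eqF.
  have : 0 <= slope * d by []. rewrite /L; lra.
have GF : (\int[lebesgue_square R]_x ((G x + d) `^ s)%:E <=
    (cs * cs)%:E * \int[lebesgue_square R]_x (F x `^ s)%:E + (cs * (e / C3))%:E)%E.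
  apply: le_trans (integral_le_lin _ _ mw _ _ _ _ _ step2) _; rewrite ?mulr_ge0 ?(ltW cs0)//.
  - by apply: measurable_powR_comp; exact: measurable_funD.
  - exact: measurable_powR_comp.
  - by move=> x; exact: powR_ge0.
  - by move=> x; exact: powR_ge0.
  - by move=> x; exact: powR_ge0.
  by rewrite leeD2l// EFinM lee_pmul2l.
apply: le_trans (integral_le_lin _ _ mw _ _ _ _ _ step1) _; rewrite ?(ltW c20)//.
- by apply: measurable_powR_comp; apply: measurable_normc; exact: cmeasurable_sum.
- by apply: measurable_powR_comp; apply: measurable_normc; exact: cmeasurable_sum.
- by move=> x; exact: powR_ge0.
- by move=> x; exact: powR_ge0.
- by move=> x; exact: powR_ge0.
have := bound K I1 I2 A c disj (fun k => (Ac k).1) d d0 => gb.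
apply: (@le_trans _ _ (c2%:E * (C%:E * ((cs * cs)%:E * \int[lebesgue_square R]_x (F x `^ s)%:E
     + (cs * (e / C3))%:E)) + c2%:E * (e / C3)%:E)%E).
  apply: leeD; last by rewrite lee_pmul2l.
  rewrite lee_pmul2l//; apply: le_trans gb _; rewrite lee_pmul2l//.
have : (0 <= \int[lebesgue_square R]_x (F x `^ s)%:E)%E.
  by apply: integral_ge0 => x _; rewrite lee_fin powR_ge0.
case: (\int[_]_x _)%E => [r r0| _|//]; last first.
  by rewrite [in leRHS]gt0_muley ?lte_fin ?mulr_gt0// addye// leey.
rewrite -!EFinM -!EFinD -?EFinM -?EFinD -?EFinM -?EFinD -?EFinM lee_fin.
have -> : c2 * (C * (cs * cs * r + cs * (e / C3))) + c2 * (e / C3) =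
  c2 * (C * (cs * cs)) * r + e * ((c2 * (C * cs + 1)) / C3) by ring.
by rewrite -/C3 mulfV ?gt_eqF// mulr1.
Qed.


(** * Completeness of Lp *)
Section ExtendedReals.
Variable R : realType.
Implicit Types (u : (\bar R)^nat) (a b : \bar R) (q : R).

Lemma cvg0_le u : u n @[n --> \oo] --> 0%E ->
  forall e : R, 0 < e -> \forall n \near \oo, (u n <= e%:E)%E.
Proof.
move=> cu e e0.
have h : \forall n \near \oo, (u n < e%:E)%E.
  exact: (cu _ (nbhs_open_ereal_lt (f := fun=> e) e0)).
by apply: filterS h => n /ltW.
Qed.

Lemma le_cvg0 u : (forall n, 0 <= u n)%E ->
  (forall e : R, 0 < e -> \forall n \near \oo, (u n <= e%:E)%E) ->
  u n @[n --> \oo] --> 0%E.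
Proof.
move=> u0 h; apply/fine_cvgP; split.
  apply: filterS (h 1 ltr01) => n un.
  by rewrite ge0_fin_numE// (le_lt_trans un)// ltry.
apply/cvgrPdist_le => e e0; apply: filterS (h e e0) => n un /=.
rewrite sub0r normrN ger0_norm ?fine_ge0//.
by rewrite -lee_fin fineK// ge0_fin_numE// (le_lt_trans un)// ltry.
Qed.

Lemma ge0_le_poweR a b q : 0 <= q -> (0 <= a)%E -> (a <= b)%E -> (a `^ q <= b `^ q)%E.
Proof.
move=> q0 a0 ab; apply: gt0_ler_poweR => //; rewrite in_itv/= leey andbT//.
exact: le_trans ab.
Qed.

Lemma poweR_cvg0 u q : 0 < q -> (forall n, 0 <= u n)%E ->
  u n @[n --> \oo] --> 0%E -> (u n `^ q)%E @[n --> \oo] --> 0%E.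
Proof.
move=> q0 u0 cu; apply: le_cvg0 => [n|e e0]; first exact: poweR_ge0.
apply: filterS (cvg0_le cu (powR_gt0 q^-1 e0)) => n un.
apply: le_trans (ge0_le_poweR (ltW q0) (u0 n) un) _.
by rewrite poweR_EFin -powRrM mulVf ?gt_eqF// powRr1// ltW.
Qed.

(** Turns inequalities between integrals of p-th powers into inequalities between
norms. *)
Lemma poweR_root_le a b q c : 0 < q -> 0 <= c -> (0 <= a)%E -> (0 <= b)%E ->
  (a `^ q <= c%:E * b `^ q)%E -> (a <= (c `^ q^-1)%:E * b)%E.
Proof.
move=> q0 c0 a0 b0 ab.
have qV : q * q^-1 = 1 by rewrite mulfV// gt_eqF.
have -> : a = ((a `^ q) `^ q^-1)%E by rewrite -poweRrM qV poweRe1.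
have -> : ((c `^ q^-1)%:E * b = (c%:E * b `^ q) `^ q^-1)%E.
  by rewrite poweRM ?lee_fin ?poweR_ge0// -poweRrM qV poweRe1.
by apply: ge0_le_poweR; rewrite ?invr_ge0 ?(ltW q0) ?poweR_ge0.
Qed.

Lemma limn_einf_le u a : (forall n, u n <= a)%E -> (limn_einf u <= a)%E.
Proof.
move=> ua; rewrite limn_einf_lim; apply: lime_le; first exact: is_cvg_einfs.
apply: nearW => n; apply: le_trans (ua n).
by apply: ereal_inf_lbound; exists n => /=.
Qed.

(** s^(p-1) >= (s/t) t^(p-1) because p - 1 <= 1, hence
t^p - s^p <= t^(p-2) (t^2 - s^2). *)
Lemma powR_lipschitz (p s t : R) : 1 <= p -> p <= 2 -> 0 <= s -> s <= t ->
  t `^ p - s `^ p <= 2 * t `^ (p - 1) * (t - s).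
Proof.
move=> p1 p2 s0 st; have p0 : 0 < p by lra.
have [t0|tn] := eqVneq t 0.
  have -> : s = 0 by lra.
  by rewrite t0 !subrr mulr0.
have tp : 0 < t by rewrite lt_neqAle eq_sym tn; exact: le_trans st.
rewrite -(mulr_powRB1 s0 p0) -(mulr_powRB1 (ltW tp) p0).
set w := t `^ (p - 1); have w0 : 0 <= w by exact: powR_ge0.
pose k := s / t.
have k0 : 0 <= k by rewrite divr_ge0// ltW.
have k1 : k <= 1 by rewrite ler_pdivrMr// mul1r.
have sk : s = k * t by rewrite /k divfK.
have h : k * w <= s `^ (p - 1).
  rewrite sk powRM// ?(ltW tp)// ler_wpM2r//.
  have [ke|kn] := eqVneq k 0; first by rewrite ke powR_ge0.
  by apply: ger1_powR; [rewrite k1 andbT lt_neqAle eq_sym kn | lra].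
have : s * (k * w) <= s * s `^ (p - 1) by rewrite ler_wpM2l.
have sq : 0 <= w * t * (1 - k) ^+ 2.
  by apply: mulr_ge0; [apply: mulr_ge0 => //; exact: ltW | exact: sqr_ge0].
have -> : s * (k * w) = k ^+ 2 * (w * t) by rewrite {1}sk; ring.
have -> : 2 * w * (t - s) = 2 * (w * t) * (1 - k) by rewrite sk; ring.
move: sq; set z := s * _; set y := w * t.
have -> : t * w = y by rewrite mulrC.
have -> : y * (1 - k) ^+ 2 = y - 2 * (k * y) + k ^+ 2 * y by ring.
have -> : 2 * y * (1 - k) = 2 * y - 2 * (k * y) by ring.
lra.
Qed.

Lemma powR_cvg (p : R) (u : R^nat) (a : R) : 1 <= p -> p <= 2 ->
  (forall n, 0 <= u n) -> 0 <= a ->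
  u n @[n --> \oo] --> a -> u n `^ p @[n --> \oo] --> a `^ p.
Proof.
move=> p1 p2 u0 a0 cu; pose L := 2 * (a + 1) `^ (p - 1).
have L0 : 0 < L by rewrite mulr_gt0// powR_gt0// ltr_wpDl.
have p10 : 0 <= p - 1 by lra.
apply/cvgrPdist_le => e e0.
have e1 : 0 < Num.min 1 (e / L) by rewrite lt_min ltr01 divr_gt0.
have /cvgrPdist_le/(_ _ e1) cu' := cu; apply: filterS cu' => n.
rewrite le_min => /andP[d1 d2].
have key s t : 0 <= s -> s <= t -> t <= a + 1 -> t `^ p - s `^ p <= L * (t - s).
  move=> s0 st ta; apply: le_trans (powR_lipschitz p1 p2 s0 st) _.
  rewrite ler_wpM2r ?subr_ge0// /L ler_wpM2l//.
  apply: ge0_ler_powR => //; rewrite ?nnegrE//; first exact: le_trans st.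
  by rewrite addr_ge0.
have Ld : L * `|a - u n| <= e by rewrite mulrC -ler_pdivlMr.
apply: le_trans Ld; have [ua|au] := leP (u n) a.
  rewrite !ger0_norm ?subr_ge0//; first by apply: key; rewrite ?lerDl.
  by apply: ge0_ler_powR; rewrite ?nnegrE//; lra.
have un : u n <= a + 1 by move: d1; rewrite ler_distl; lra.
rewrite (distrC a) (distrC (a `^ p)) !ger0_norm ?subr_ge0 ?(ltW au)//.
  by apply: key => //; exact: ltW.
by apply: ge0_ler_powR; rewrite ?nnegrE ?(ltW au)//; lra.
Qed.

Lemma fin_num_normed_series (d : R^nat) (b : R^nat) : (forall j, `|d j| <= b j) ->
  (\sum_(0 <= j <oo) (b j)%:E < +oo)%E -> cvgn (series d).
Proof.
move=> db fin; apply: normed_cvg; apply: nondecreasing_is_cvgn.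
  by apply: nondecreasing_series => n _ _; exact: normr_ge0.
have b0 n : 0 <= b n by exact: le_trans (db n).
have Gf : (\sum_(0 <= j <oo) (b j)%:E)%E \is a fin_num.
  by rewrite ge0_fin_numE// nneseries_ge0// => n _ _; rewrite lee_fin.
exists (fine (\sum_(0 <= j <oo) (b j)%:E)%E) => _ [n _ <-].
rewrite -lee_fin fineK// /series/= -sumEFin.
apply: le_trans (nneseries_lim_ge n _); last by move=> k _ _; rewrite lee_fin.
by apply: lee_sum => k _; rewrite lee_fin.
Qed.

End ExtendedReals.


Section Completeness.
Variables (R : realType) (p : R).
Hypotheses (p1 : 1 < p) (p2 : p <= 2).
Local Notation T := (measurableTypeR R * measurableTypeR R)%type.
Local Notation mu := (lebesgue_square R).
Local Notation normc := (@Normc.normc R).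
Variables (S : nat -> T -> R[i]) (r : nat -> \bar R).
Hypothesis mS : forall n, cmeasurable (S n).
Hypothesis r0 : r n @[n --> \oo] --> 0%E.
Hypothesis Sr : forall m n, (m <= n)%N ->
  (\int[mu]_x (normc (S n x - S m x) `^ p)%:E <= r m)%E.

Let half j : R := 1 / (2 ^ (j + 1))%:R.

Let half_gt0 j : 0 < half j.
Proof. by rewrite divr_gt0// ltr0n expn_gt0. Qed.

Let measurable_norm_diff m n : measurable_fun setT (fun x => normc (S n x - S m x)).
Proof. by apply: measurable_normc; exact: cmeasurableB. Qed.

Let cauchy_L1 j : exists N, forall m n, (N <= m)%N -> (m <= n)%N ->
  (\int[mu]_x (normc (S n x - S m x))%:E <= (half j)%:E)%E.
Proof.
(* t <= eta + eta^(1-p) t^p compares L^1 with L^p, and both terms become eta *)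
pose eta := half j / 2; have eta0 : 0 < eta by rewrite divr_gt0.
have [N _ hN] := cvg0_le r0 (powR_gt0 p eta0).
exists N => m n Nm mn.
have p0 : 0 < p by exact: lt_trans p1.
have le x : normc (S n x - S m x) <=
    eta * 1 + eta `^ (1 - p) * normc (S n x - S m x) `^ p.
  set t := normc _; have t0 : 0 <= t by exact: normc_ge0.
  rewrite mulr1; have [te|et] := leP t eta.
    by rewrite -[leLHS]addr0 lerD// mulr_ge0 ?powR_ge0.
  have tp : 0 < t by exact: lt_trans et.
  have -> : t = t `^ (1 - p) * t `^ p.
    by rewrite -powRD ?subrK ?powRr1// (gt_eqF tp) implybT.
  rewrite -[leLHS]add0r lerD ?(ltW eta0)//.
  have -> : (t `^ (1 - p) * t `^ p) `^ p = t `^ p.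
    by rewrite -powRD ?subrK ?powRr1// (gt_eqF tp) implybT.
  rewrite ler_wpM2r ?powR_ge0//; apply: powR_le_npos => //; first exact: ltW.
  by rewrite subr_le0 ltW.
apply: le_trans (integral_le_lin _ _ _ _ _ _ _ _ le) _ => //.
- exact: measurable_powR_comp.
- by move=> x; exact: normc_ge0.
- by move=> x; exact: powR_ge0.
- exact: ltW.
- exact: powR_ge0.
rewrite integral_cst// lebesgue_squareT mule1 mule1.
apply: (@le_trans _ _ (eta%:E + (eta `^ (1 - p))%:E * (eta `^ p)%:E)%E).
  rewrite leeD2l// lee_pmul2l ?lte_fin ?powR_gt0//.
  by apply: le_trans (Sr mn) _; apply: hN.
rewrite -EFinM -EFinD lee_fin -powRD ?subrK; last by rewrite (gt_eqF eta0) implybT.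
by rewrite powRr1 ?(ltW eta0)// /eta; lra.
Qed.

(** Along a subsequence m_j the differences are summable in L^1, so that the
subsequence converges almost everywhere; the limit F is set to 0 elsewhere.
Fatou's lemma transfers the Cauchy estimate to S_n - F. *)
Lemma Lp_complete : exists2 F : T -> R[i], cmeasurable F &
  forall n, (\int[mu]_x (normc (S n x - F x) `^ p)%:E <= r n)%E.
Proof.
have [N hN] := choice cauchy_L1.
(* increasing, at least j, and past the j-th Cauchy threshold N j *)
pose m j := (j + \sum_(i < j.+1) N i)%N.
have Nm j : (N j <= m j)%N by rewrite /m big_ord_recr/=; lia.
have jm j : (j <= m j)%N by rewrite /m leq_addr.
have mS' j : (m j <= m j.+1)%N by rewrite /m [in X in (_ <= X)%N]big_ord_recr/=; lia.
pose d j x := S (m j.+1) x - S (m j) x.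
pose G x := (\sum_(0 <= j <oo) (normc (d j x))%:E)%E.
have mnd j : measurable_fun setT (fun x => (normc (d j x))%:E).
  by apply/measurable_EFinP; exact: measurable_norm_diff.
have nd0 j x : (0 <= (normc (d j x))%:E)%E by rewrite lee_fin normc_ge0.
have G0 x : (0 <= G x)%E by apply: nneseries_ge0.
have mG : measurable_fun setT G by apply: ge0_emeasurable_sum.
have intG : (\int[mu]_x G x < +oo)%E.
  rewrite integral_nneseries//.
  apply: (@le_lt_trans _ _ (\sum_(0 <= j <oo) (half j)%:E)%E).
    by apply: lee_nneseries => [j _ _|j _]; [exact: integral_ge0 | exact: hN].
  have /cvg_lim -> // := @cvg_geometric_eseries_half R 1 0.
  by rewrite ltry.
have mD : measurable [set x | (G x < +oo)%E].
  rewrite -[X in measurable X]setTI; exact: emeasurable_fun_infty_o.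
set D := [set x | (G x < +oo)%E] in mD.
have aeD : {ae mu, forall x, D x}.
  have iG : mu.-integrable setT G.
    apply/integrableP; split => //.
    by under eq_integral do rewrite gee0_abs//.
  have := integrable_ae measurableT iG.
  by apply: filterS => x /(_ Logic.I); rewrite ge0_fin_numE.
have mindic : measurable_fun setT (\1_D : T -> R) by exact: measurable_indic.
have lim_part (P : R[i] -> R) :
    (forall z, `|P z| <= normc z) -> (forall z w, P (z - w) = P z - P w) ->
    (forall n, measurable_fun setT (fun x => P (S n x))) ->
    exists2 g : T -> R, measurable_fun setT g &
      forall x, D x -> P (S (m j) x) @[j --> \oo] --> g x.
  move=> Pn PB mP; pose phi j x := \1_D x * P (S (m j) x) : R.
  have cphi x : D x -> cvgn (fun j => P (S (m j) x)).
    move=> Dx; have h := fin_num_normed_series (d := fun j => P (d j x)) (fun j => Pn _) Dx.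
    rewrite (_ : (fun j => _) = fun j => P (S (m 0%N) x) + series (fun j => P (d j x)) j).
      by apply: is_cvgD => //; exact: is_cvg_cst.
    apply/funext; elim=> [|j IH]; first by rewrite /series/= big_geq// addr0.
    by rewrite /series/= big_nat_recr//= addrA -[X in X + _]IH /d PB addrC subrK.
  have cphi' x : cvgn (phi ^~ x).
    have [Dx|nDx] := pselect (D x).
      rewrite (_ : phi ^~ x = fun j => P (S (m j) x)); first exact: cphi.
      by apply/funext => j; rewrite /phi indicE mem_set// mul1r.
    rewrite (_ : phi ^~ x = fun=> 0); first exact: is_cvg_cst.
    by apply/funext => j; rewrite /phi indicE memNset// mul0r.
  exists (fun x => limn (phi ^~ x)).
    apply: (measurable_fun_cvg (h := phi)) => [j|x _]; last exact: cphi'.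
    by apply: measurable_funM.
  move=> x Dx; have := cphi' x; rewrite (_ : phi ^~ x = fun j => P (S (m j) x))//.
  by apply/funext => j; rewrite /phi indicE mem_set// mul1r.
have ReN z : `|complex.Re z| <= normc z.
  rewrite -ler_sqr ?nnegrE ?normc_ge0// normcE_sqr real_normK ?num_real//.
  by rewrite lerDl sqr_ge0.
have ImN z : `|complex.Im z| <= normc z.
  rewrite -ler_sqr ?nnegrE ?normc_ge0// normcE_sqr real_normK ?num_real//.
  by rewrite lerDr sqr_ge0.
have ReB (z w : R[i]) : complex.Re (z - w) = complex.Re z - complex.Re w.
  by case: z w => a b [a' b'].
have ImB (z w : R[i]) : complex.Im (z - w) = complex.Im z - complex.Im w.
  by case: z w => a b [a' b'].
have [gr mgr hgr] := lim_part (@complex.Re R) ReN ReB (fun n => (mS n).1).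
have [gi mgi hgi] := lim_part (@complex.Im R) ImN ImB (fun n => (mS n).2).
pose F x := Complex (gr x) (gi x); exists F => [//|n].
have mF : cmeasurable F by [].
pose v j x := (normc (S (m (j + n)%N) x - S n x) `^ p)%:E.
have mv j : measurable_fun setT (v j).
  by apply/measurable_EFinP; apply: measurable_powR_comp; exact: measurable_norm_diff.
have v0 j x : (0 <= v j x)%E by rewrite lee_fin powR_ge0.
have fat := fatou mu measurableT mv (fun j x _ => v0 j x).
have bound : (limn_einf (fun j => \int[mu]_x v j x) <= r n)%E.
  apply: limn_einf_le => j; apply: Sr; apply: leq_trans (jm _).
  by rewrite leq_addl.
apply: le_trans (le_trans fat bound).
apply: ae_ge0_le_integral => //.
- by move=> x _; rewrite lee_fin powR_ge0.
- apply/measurable_EFinP; apply: measurable_powR_comp; apply: measurable_normc.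
  exact: cmeasurableB.
- move=> x _; rewrite limn_einf_lim; apply: lime_ge; first exact: is_cvg_einfs.
  by apply: nearW => j; apply/ereal_infP => _ [k _ <-].
- rewrite (_ : (fun x => limn_einf _) = fun x => - limn_esup (fun j => - v j x))%E.
    apply: measurableT_comp => //; apply: measurable_fun_limn_esup => j.
    exact: measurableT_comp.
  by apply/funext => x; rewrite limn_esupN oppeK.
apply: filterS aeD => x Dx _.
have normE (z : R[i]) : normc z = Num.sqrt (complex.Re z ^+ 2 + complex.Im z ^+ 2).
  by rewrite -normcE_sqr sqrtr_sqr ger0_norm ?normc_ge0.
have lim : normc (S (m (j + n)%N) x - S n x) @[j --> \oo] --> normc (F x - S n x).
  have hr : complex.Re (S (m (j + n)%N) x) @[j --> \oo] --> gr x.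
    by have := hgr x Dx; rewrite -(cvg_shiftn n).
  have hi : complex.Im (S (m (j + n)%N) x) @[j --> \oo] --> gi x.
    by have := hgi x Dx; rewrite -(cvg_shiftn n).
  have sq (u : R^nat) (a b : R) : u j @[j --> \oo] --> a ->
      (u j - b) ^+ 2 @[j --> \oo] --> (a - b) ^+ 2.
    by move=> cu; apply: cvgM; apply: cvgB => //; exact: cvg_cst.
  have csqrt (u : R^nat) (a : R) : u j @[j --> \oo] --> a ->
      Num.sqrt (u j) @[j --> \oo] --> Num.sqrt a.
    by move=> cu; apply: cvg_comp; [exact: cu | exact: sqrt_continuous].
  have h := csqrt _ _ (cvgD (sq _ _ (complex.Re (S n x)) hr) (sq _ _ (complex.Im (S n x)) hi)).
  rewrite normE ReB ImB /=.
  rewrite (_ : (fun j => normc _) = fun j => Num.sqrt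
      ((complex.Re (S (m (j + n)%N) x) - complex.Re (S n x)) ^+ 2 +
       (complex.Im (S (m (j + n)%N) x) - complex.Im (S n x)) ^+ 2)); first exact: h.
  by apply/funext => j; rewrite normE ReB ImB.
have hp := powR_cvg (ltW p1) p2 (fun j => normc_ge0 _) (normc_ge0 _) lim.
have h : v j x @[j --> \oo] --> (normc (F x - S n x) `^ p)%:E.
  by apply: cvg_EFin; [exact: nearW | exact: hp].
have -> : limn_einf (v ^~ x) = (normc (F x - S n x) `^ p)%:E.
  by have [-> _] := cvg_limn_einf_sup h.
by rewrite -(normcN (F x - S n x)) opprB.
Qed.

End Completeness.


(** * Countable families *)
Section SquareFunctionNorm.
Variables (R : realType) (p : R).
Hypothesis p0 : 0 < p.
Local Notation T := (measurableTypeR R * measurableTypeR R)%type.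
Local Notation mu := (lebesgue_square R).
Local Notation normc := (@Normc.normc R).

Lemma square_function_poweR (K : choiceType) (f : K -> T -> R[i]) :
  ('N[mu]_(p%:E)[square_function f] `^ p =
   \int[mu]_x (\esum_(k in [set: K]) (normc (f k x) ^+ 2)%:E) `^ (p / 2))%E.
Proof.
rewrite poweR_Lnorm ?gt_eqF//; apply: eq_integral => x _.
by rewrite /square_function gee0_abs ?poweR_ge0// -poweRrM mulrC.
Qed.

Lemma esum_finType (K : finType) (a : K -> \bar R) : (forall k, 0 <= a k)%E ->
  (\esum_(k in [set: K]) a k = \sum_k a k)%E.
Proof.
move=> a0; rewrite esum_fset//; last exact: finite_finset.
rewrite (fsbig_fwiden (index_enum K)) ?index_enum_uniq//.
  by move=> k _ /=; rewrite mem_index_enum.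
by move=> k [_ []].
Qed.

End SquareFunctionNorm.

Lemma big_nat_shift (A : Type) (idx : A) (op : A -> A -> A) m n (h : nat -> A) :
  \big[op/idx]_(m <= k < m + n) h k = \big[op/idx]_(i < n) h (m + i)%N.
Proof.
rewrite -{1}[m]add0n big_addn addKn big_mkord.
by apply: eq_bigr => i _; rewrite addnC.
Qed.

Section CountableFamily.
Variables (R : realType) (p C : R).
Hypotheses (p1 : 1 < p) (p2 : p <= 2) (C0 : 0 < C).
Local Notation T := (measurableTypeR R * measurableTypeR R)%type.
Local Notation mu := (lebesgue_square R).
Local Notation normc := (@Normc.normc R).
Variable f : nat -> T -> R[i].
Hypothesis mf : forall k, cmeasurable (f k).
Hypothesis window : forall m n,
  (\int[mu]_x (normc (\sum_(i < n) f (m + i)%N x) `^ p)%:E <=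
   C%:E * \int[mu]_x ((\sum_(i < n) normc (f (m + i)%N x) ^+ 2) `^ (p / 2))%:E)%E.

Let tail m x : \bar R := (\sum_(m <= k <oo) (normc (f k x) ^+ 2)%:E)%E.
Let rho m : \bar R := (\int[mu]_x (tail m x `^ (p / 2)))%E.

Hypothesis rho_fin : (rho 0 < +oo)%E.

Let p0 : 0 < p. Proof. exact: lt_trans p1. Qed.
Let s0 : 0 < p / 2. Proof. by rewrite divr_gt0. Qed.

Let term_ge0 k x : (0 <= (normc (f k x) ^+ 2)%:E)%E.
Proof. by rewrite lee_fin sqr_ge0. Qed.

Let tail_ge0 m x : (0 <= tail m x)%E.
Proof. exact: nneseries_ge0. Qed.

Let measurable_term k : measurable_fun setT (fun x => (normc (f k x) ^+ 2)%:E).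
Proof. by apply/measurable_EFinP; exact: measurable_normc_sqr. Qed.

Let measurable_tail m : measurable_fun setT (tail m).
Proof.
rewrite (_ : tail m = fun x => \sum_(0 <= k <oo | (m <= k)%N) (normc (f k x) ^+ 2)%:E)%E.
  exact: ge0_emeasurable_sum.
by apply/funext => x; rewrite /tail eseries_cond.
Qed.

Let measurable_tail_pow m : measurable_fun setT (fun x => tail m x `^ (p / 2))%E.
Proof. by apply: (measurableT_comp (measurable_poweR _)). Qed.

Let window_tail m n x : ((\sum_(i < n) normc (f (m + i)%N x) ^+ 2)%:E <= tail m x)%E.
Proof.
rewrite /tail (nneseries_split m n)//.
rewrite -sumEFin -[leLHS]adde0 leeD//; last exact: nneseries_ge0.
by rewrite big_nat_shift.
Qed.

Let tail_cvg : rho m @[m --> \oo] --> 0%E.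
Proof.
have mg : mu.-integrable setT (fun x => tail 0 x `^ (p / 2))%E.
  apply/integrableP; split => //.
  by under eq_integral do rewrite gee0_abs ?poweR_ge0//.
have aefin : {ae mu, forall x, (tail 0 x < +oo)%E}.
  apply: filterS (integrable_ae measurableT mg) => x /(_ Logic.I).
  rewrite ge0_fin_numE ?poweR_ge0// => /lty_poweRy; apply.
  by rewrite gt_eqF.
have h1 : {ae mu, forall x, setT x -> (tail m x `^ (p / 2))%E @[m --> \oo] --> 0%E}.
  apply: filterS aefin => x fx _; apply: poweR_cvg0 => //.
  exact: (nneseries_tail_cvg fx).
have h2 : {ae mu, forall x, forall m, setT x ->
    (`|tail m x `^ (p / 2)| <= tail 0 x `^ (p / 2))%E}.
  apply: aeW => x m _; rewrite gee0_abs ?poweR_ge0//.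
  apply: ge0_le_poweR => //; first exact: ltW.
  by rewrite [leRHS](nneseries_split 0 m)// add0n leeDr// sume_ge0.
have [_ _] := dominated_convergence (f := fun=> 0%E) measurableT measurable_tail_pow
  (measurable_cst _) h1 mg h2.
by rewrite integral0.
Qed.

Let S n x := \sum_(k < n) f k x.

Let S_diff m n : (m <= n)%N ->
  (\int[mu]_x (normc (S n x - S m x) `^ p)%:E <= C%:E * rho m)%E.
Proof.
move=> mn.
have -> : (\int[mu]_x (normc (S n x - S m x) `^ p)%:E =
    \int[mu]_x (normc (\sum_(i < n - m) f (m + i)%N x) `^ p)%:E)%E.
  apply: eq_integral => x _; congr (EFin (normc _ `^ p)).
  rewrite /S -!(big_mkord predT (fun k => f k x)) (big_cat_nat (n := m))//= addrC addrK.
  by rewrite -{1}(subnKC mn) big_nat_shift.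
apply: le_trans (window m (n - m)) _; rewrite lee_pmul2l//.
apply: ge0_le_integral => //.
- by move=> x _; rewrite lee_fin powR_ge0.
- apply/measurable_EFinP; apply: measurable_powR_comp; apply: measurable_sum => i.
  exact: measurable_normc_sqr.
- move=> x _; rewrite -poweR_EFin; apply: ge0_le_poweR; rewrite ?(ltW s0)//.
  by rewrite lee_fin sumr_ge0// => i _; rewrite sqr_ge0.
Qed.

Let cmeasurable_S n : cmeasurable (S n).
Proof. exact: cmeasurable_sum. Qed.

Let C_rho_cvg : (C%:E * rho m)%E @[m --> \oo] --> 0%E.
Proof. by rewrite -(mule0 C%:E); apply: cvgeZl. Qed.

Let rho_ge0 m : (0 <= rho m)%E.
Proof. by apply: integral_ge0 => x _; exact: poweR_ge0. Qed.

Let S_bound n : (\int[mu]_x (normc (S n x) `^ p)%:E <= C%:E * rho 0)%E.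
Proof.
have := S_diff (leq0n n); congr (_ <= _)%E; apply: eq_integral => x _.
by rewrite /S big_ord0 subr0.
Qed.

Let limit_bound F : cmeasurable F -> forall e : R,
  (exists n, (\int[mu]_x (normc (S n x - F x) `^ p)%:E <= e%:E)%E) ->
  (\int[mu]_x (normc (F x) `^ p)%:E <= (2 `^ p)%:E * (C%:E * rho 0) + (2 `^ p * e)%:E)%E.
Proof.
move=> mF e [n he].
have le x : normc (F x) `^ p <=
    2 `^ p * normc (S n x) `^ p + 2 `^ p * normc (S n x - F x) `^ p.
  rewrite -mulrDr; apply: le_trans (powR_add_le (ltW p0) (normc_ge0 _) (normc_ge0 _)).
  apply: ge0_ler_powR; rewrite ?(ltW p0) ?nnegrE ?addr_ge0 ?normc_ge0//.
  have FE : F x = S n x - (S n x - F x) by rewrite opprB addrCA subrr addr0.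
  by rewrite {1}FE; apply: le_trans (normc_triangle _ _) _; rewrite normcN.
apply: le_trans (integral_le_lin _ _ _ _ _ _ _ _ le) _; rewrite ?powR_ge0//.
- by apply: measurable_powR_comp; exact: measurable_normc.
- by apply: measurable_powR_comp; exact: measurable_normc.
- by apply: measurable_powR_comp; apply: measurable_normc; exact: cmeasurableB.
- by move=> x; exact: powR_ge0.
- by move=> x; exact: powR_ge0.
- by move=> x; exact: powR_ge0.
apply: leeD; first by rewrite lee_pmul2l ?lte_fin ?powR_gt0.
by rewrite EFinM lee_pmul2l ?lte_fin ?powR_gt0.
Qed.

Lemma countable_limit_exists : exists F, Lp_limit \oo p S F.
Proof.
have [F mF hF] := Lp_complete p1 p2 cmeasurable_S C_rho_cvg S_diff.
have pn0 : p != 0 by rewrite gt_eqF.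
have cn0 g : (0 <= cnorm p g)%E by exact: Lnorm_ge0.
exists F; split.
  split; [exact: mF.1 | exact: mF.2 | ].
  apply: (@lty_poweRy _ _ p) => //; rewrite cnorm_poweR//.
  have [N _ hN] := cvg0_le C_rho_cvg ltr01.
  have := @limit_bound F mF 1 (ex_intro _ N (le_trans (hF N) (hN N (leqnn N)))).
  move=> /le_lt_trans; apply; rewrite lte_add_pinfty ?ltry//.
  by rewrite !lte_mul_pinfty// ?lee_fin ?powR_ge0 ?(ltW C0)// mule_ge0// lee_fin ltW.
have root g : cnorm p g = (cnorm p g `^ p `^ p^-1)%E.
  by rewrite -poweRrM mulfV// poweRe1.
under eq_fun do rewrite root cnorm_poweR//.
apply: poweR_cvg0; first by rewrite invr_gt0.
  by move=> n; apply: integral_ge0 => x _; rewrite lee_fin powR_ge0.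
apply: le_cvg0 => [n|e e0].
  by apply: integral_ge0 => x _; rewrite lee_fin powR_ge0.
by apply: filterS (cvg0_le C_rho_cvg e0) => n; exact: le_trans.
Qed.

(** Compare F with a partial sum close to it: |F|^p <= 2^p (|S|^p + |S - F|^p). *)
Lemma countable_limit_bound F : Lp_limit \oo p S F ->
  (cnorm p F `^ p <= (2 `^ p * C)%:E * rho 0)%E.
Proof.
move=> [[mFr mFi _] cF]; have pn0 : p != 0 by rewrite gt_eqF.
rewrite cnorm_poweR//; apply/lee_addgt0Pr => e e0.
have e20 : 0 < e / 2 `^ p by rewrite divr_gt0// powR_gt0.
have [N _ hN] := cvg0_le cF (powR_gt0 p^-1 e20).
have -> : e = 2 `^ p * (e / 2 `^ p) by rewrite mulrC divfK// gt_eqF// powR_gt0.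
rewrite EFinM -muleA; apply: limit_bound => //; exists N.
rewrite -cnorm_poweR//; apply: le_trans (ge0_le_poweR (ltW p0) _ (hN N (leqnn N))) _.
  exact: Lnorm_ge0.
by rewrite poweR_EFin -powRrM mulVf// powRr1// ltW.
Qed.

End CountableFamily.

Theorem theorem1 (R : realType) (p : R) (hp1 : 1 < p) (hp2 : p <= 2) :
  exists C : R, 0 < C /\
    (* finite families *)
    (forall (K : finType) (I1 I2 : K -> set nat)
        (f : K -> measurableTypeR R * measurableTypeR R -> R[i]),
      disjoint_rectangles I1 I2 -> walsh_family I1 I2 f ->
      (cnorm p (fun x => (\sum_(k : K) f k x)%R)
         <= C%:E * 'N[lebesgue_square R]_(p%:E)[square_function f])%E) /\
    (* infinite countable families *)
    (forall (I1 I2 : nat -> set nat)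
        (f : nat -> measurableTypeR R * measurableTypeR R -> R[i]),
      disjoint_rectangles I1 I2 -> walsh_family I1 I2 f ->
      ('N[lebesgue_square R]_(p%:E)[square_function f] < +oo)%E ->
      (exists F, Lp_limit \oo p (fun N x => \sum_(k < N) f k x) F) /\
      (forall F, Lp_limit \oo p (fun N x => \sum_(k < N) f k x) F ->
        (cnorm p F
           <= C%:E * 'N[lebesgue_square R]_(p%:E)[square_function f])%E)).
Proof.
have [C C0 bound] := finite_family_bound hp1 hp2.
have p0 : 0 < p by exact: lt_trans hp1.
have pn0 : p != 0 by rewrite gt_eqF.
have C10 : 0 < 2 `^ p * C by rewrite mulr_gt0// powR_gt0.
have two1 : 1 <= 2 `^ p :> R.
  by rewrite -[leLHS](powRr0 2); apply: ler_powR; [rewrite ler1n | exact: ltW].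
exists ((2 `^ p * C) `^ p^-1); split; first exact: powR_gt0.
split=> [K I1 I2 f disj fam|I1 I2 f disj fam fin].
  apply: poweR_root_le => //; rewrite ?(ltW C10) ?Lnorm_ge0//.
  rewrite cnorm_poweR// square_function_poweR//.
  have -> : (\int[lebesgue_square R]_x
      (\esum_(k in [set: K]) (Normc.normc (f k x) ^+ 2)%:E) `^ (p / 2) =
      \int[lebesgue_square R]_x ((\sum_k Normc.normc (f k x) ^+ 2) `^ (p / 2))%:E)%E.
    apply: eq_integral => x _; rewrite esum_finType ?sumEFin ?poweR_EFin// => k.
    by rewrite lee_fin sqr_ge0.
  apply: le_trans (bound K I1 I2 f disj fam) _; apply: lee_wpmul2r.
    by apply: integral_ge0 => x _; rewrite lee_fin powR_ge0.
  by rewrite lee_fin ler_peMl// ltW.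
have mf k : cmeasurable (f k) by have [[]] := fam k.
have window m n :
    (\int[lebesgue_square R]_x (Normc.normc (\sum_(i < n) f (m + i)%N x) `^ p)%:E <=
     C%:E * \int[lebesgue_square R]_x
       ((\sum_(i < n) Normc.normc (f (m + i)%N x) ^+ 2) `^ (p / 2))%:E)%E.
  apply: (bound 'I_n (fun i => I1 (m + i)%N) (fun i => I2 (m + i)%N)).
    have [d1 d2 d3] := disj; split => // i j _ _ ij.
    by apply/val_inj/(@addnI m); exact: d3.
  by move=> i; exact: fam.
have rhoE : ('N[lebesgue_square R]_(p%:E)[square_function f] `^ p =
    \int[lebesgue_square R]_x ((\sum_(0 <= k <oo) (Normc.normc (f k x) ^+ 2)%:E) `^ (p / 2)))%E.
  rewrite square_function_poweR//; apply: eq_integral => x _.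
  by rewrite nneseries_esumT// => k; rewrite lee_fin sqr_ge0.
have fin' : (\int[lebesgue_square R]_x
    ((\sum_(0 <= k <oo) (Normc.normc (f k x) ^+ 2)%:E) `^ (p / 2)) < +oo)%E.
  by rewrite -rhoE; exact: poweR_lty.
split; first exact: countable_limit_exists window fin'.
move=> F hF; apply: poweR_root_le => //; rewrite ?(ltW C10) ?Lnorm_ge0//.
by rewrite rhoE; apply: countable_limit_bound.
Qed.
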